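(* Let $A$ be a separable $C^*$-algebra, let $(p_n)_{n\in\mathbb N}$ be an arbitrary sequence of open projections in $A^{**}$, and let $p:=\sup_{n}p_n$ be its supremum in the lattice of projections of $A^{**}$. Then $$A_p=\bigvee_{n\in\mathbb N}A_{p_n},$$ i.e. $A_p$ coincides with the hereditary $C^*$-subalgebra of $A$ generated by the family $\{A_{p_n}\mid n\in\mathbb N\}$.
   Context: $A^{**}$ is the bidual of $A$, identified with the strong operator closure of $A$ in its universal representation. A projection $p\in A^{**}$ is open if it is the strong limit of an increasing net of positive elements of $A$. For a projection $p\in A^{**}$, $A_p:=pA^{**}p\cap A$; open projections $p$ correspond bijectively to hereditary $C^*$-subalgebras $A_p$ of $A$. It is known (Akemann) that the supremum of any set of open projections is open. $\bigvee_n A_{p_n}$ denotes the smallest (closed) hereditary $C^*$-subalgebra of $A$ containing all the $A_{p_n}$. *)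

(* Defs.v *)
From HB Require Import structures.
From mathcomp Require Import all_boot all_order all_algebra sesquilinear complex.
From mathcomp Require Import all_classical all_reals all_analysis.

Set Implicit Arguments.
Unset Strict Implicit.
Unset Printing Implicit Defensive.

Import Order.TTheory GRing.Theory Num.Theory.
Import numFieldNormedType.Exports.

Local Open Scope classical_set_scope.
Local Open Scope complex_scope.
Local Open Scope ring_scope.

(* C*-algebras are not assumed to be unital, so the product cannot be the one
   of MathComp's (unital) ring structures. *)
HB.mixin Record CompleteNormedModule_isCStarAlgebra (R : realType) A
    of CompleteNormedModule R[i] A := {
  cmul : {bilinear A -> A -> A} ;
  cstar : A -> A ;
  cmulA : associative cmul ;
  cstar_antilinear : forall (c : R[i]) (a b : A),
    cstar (c *: a + b) = c^* *: cstar a + cstar b ;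
  cstarK : involutive cstar ;
  cstarM : forall a b : A, cstar (cmul a b) = cmul (cstar b) (cstar a) ;
  cnormM : forall a b : A, `|cmul a b| <= `|a| * `|b| ;
  cnorm_star : forall a : A, `|cmul (cstar a) a| = `|a| ^+ 2
}.

#[short(type="cstarAlgType")]
HB.structure Definition CStarAlgebra (R : realType) :=
  {A of CompleteNormedModule_isCStarAlgebra R A & CompleteNormedModule R[i] A}.

(* The inner product is linear in its first argument. *)
HB.mixin Record CompleteNormedModule_isHilbert (R : realType) H
    of CompleteNormedModule R[i] H := {
  inner : {dot H for (@Num.conj R[i])} ;
  norm_inner : forall x : H, `|x| ^+ 2 = inner x x
}.

#[short(type="hilbertType")]
HB.structure Definition Hilbert (R : realType) :=
  {H of CompleteNormedModule_isHilbert R H & CompleteNormedModule R[i] H}.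

Definition separable_space (T : topologicalType) :=
  exists D : set T, countable D /\ dense D.

Section ClosedSpan.
Context {R : realType} {V : normedModType R[i]}.

Definition closed_subspace (W : set V) :=
  [/\ closed W, W 0 & forall (c : R[i]) x y, W x -> W y -> W (c *: x + y)].

Definition closed_span (S : set V) : set V := smallest closed_subspace S.

Lemma closed_span_subspace (S : set V) : closed_subspace (closed_span S).
Proof.
split.
- by apply: closed_bigI => W [[]].
- by move=> W [[]].
- by move=> c x y Sx Sy W WS; case: (WS) => -[_ _ +] _; apply; [exact: Sx|exact: Sy].
Qed.

End ClosedSpan.

Section CStarAlgebra.
Context {R : realType} {A : cstarAlgType R}.

Definition cpos (a : A) := exists x : A, a = cmul (cstar x) x.

Definition cle (a b : A) := cpos (b - a).

Definition hereditary_cstar_subalgebra (B : set A) :=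
  [/\ closed_subspace B,
      forall a b, B a -> B b -> B (cmul a b),
      forall a, B a -> B (cstar a) &
      forall a b, cpos a -> cle a b -> B b -> B a].

Definition hereditary_generated (S : set A) : set A :=
  smallest hereditary_cstar_subalgebra S.

Lemma hereditary_generated_subalgebra (S : set A) :
  hereditary_cstar_subalgebra (hereditary_generated S).
Proof.
split.
- split.
  + by apply: closed_bigI => W [[[]]].
  + by move=> W [[[]]].
  + move=> c x y Sx Sy W WS; case: (WS) => -[[_ _ +] _ _ _] _.
    by apply; [exact: Sx|exact: Sy].
- move=> a b Sa Sb W WS; case: (WS) => -[_ + _ _] _.
  by apply; [exact: Sa|exact: Sb].
- by move=> a Sa W WS; case: (WS) => -[_ _ + _] _; apply; exact: Sa.
- move=> a b a0 ab Sb W WS; case: (WS) => -[_ _ _ +] _.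
  by apply; [exact: a0|exact: ab|exact: Sb].
Qed.

(* A positive linear functional of norm one; order and norm are those of R[i],
   in which comparable elements have the same imaginary part. *)
Definition is_state (phi : A -> R[i]) :=
  [/\ scalar phi, forall a, cpos a -> 0 <= phi a &
      supremums [set `|phi a| | a in [set a : A | `|a| <= 1]] 1].

End CStarAlgebra.

Section Representation.
Context {R : realType} {A : cstarAlgType R} {H : hilbertType R}.
Implicit Types (rho : A -> H -> H) (T p q : H -> H).

Definition bounded_operator T := linear T /\ continuous T.

Definition is_representation rho :=
  [/\ forall a, bounded_operator (rho a),
      forall (c : R[i]) a b x, rho (c *: a + b) x = c *: rho a x + rho b x,
      forall a b x, rho (cmul a b) x = rho a (rho b x) &
      forall a x y, inner (rho a x) y = inner x (rho (cstar a) y)].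

Definition cyclic_subspace rho (xi : H) : set H :=
  closed_span [set rho a xi | a in setT].

(* H is the Hilbert direct sum, over all states phi of A, of the cyclic
   subspaces spanned by vectors xi phi that implement the GNS representation of
   phi. This determines rho up to unitary equivalence; the values of xi at
   functionals that are not states are irrelevant. *)
Definition is_universal_representation rho :=
  is_representation rho /\
  exists xi : (A -> R[i]) -> H,
    [/\ forall phi, is_state phi -> cyclic_subspace rho (xi phi) (xi phi),
        forall phi, is_state phi ->
          forall a, phi a = inner (rho a (xi phi)) (xi phi),
        forall phi psi, is_state phi -> is_state psi -> phi <> psi ->
          forall x y, cyclic_subspace rho (xi phi) x ->
            cyclic_subspace rho (xi psi) y -> inner x y = 0 &
        closed_span (\bigcup_(phi in is_state) cyclic_subspace rho (xi phi))
          = setT].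

(* The strong operator topology is the topology of pointwise convergence. *)
Definition bidual rho : set (H -> H) :=
  [set T | bounded_operator T /\ closure (range rho : set {ptws H -> H}) T].

Definition bidual_projection rho p :=
  [/\ bidual rho p, forall x, p (p x) = p x &
      forall x y, inner (p x) y = inner x (p y)].

Definition proj_le p q := forall x, inner (p x) x <= inner (q x) x.

Definition is_proj_sup rho (p_ : nat -> H -> H) p :=
  [/\ bidual_projection rho p, forall n, proj_le (p_ n) p &
      forall q, bidual_projection rho q -> (forall n, proj_le (p_ n) q) ->
        proj_le p q].

Definition directed_preorder (I : Type) (le : I -> I -> Prop) :=
  [/\ exists i : I, True, forall i, le i i,
      forall i j k, le i j -> le j k -> le i k &
      forall i j, exists k, le i k /\ le j k].

Definition net_filter (I : Type) (le : I -> I -> Prop) : set_system I :=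
  filter_from setT (fun i => [set j | le i j]).

Definition open_projection rho p :=
  bidual_projection rho p /\
  exists (I : Type) (le : I -> I -> Prop) (a : I -> A),
    [/\ directed_preorder le, forall i, cpos (a i),
        forall i j, le i j -> cle (a i) (a j) &
        {ptws, (fun i => rho (a i)) @ net_filter le --> p}].

(* A_p = p A** p \cap A, as a subset of A *)
Definition hereditary_of rho p : set A :=
  [set a | exists2 T, bidual rho T & rho a = p \o T \o p].

End Representation.

(* Main.v *)
Require Import Defs.
From HB Require Import structures.
From mathcomp Require Import all_boot all_order all_algebra sesquilinear complex.
From mathcomp Require Import all_classical all_reals all_analysis.
From mathcomp Require Import lra ring.

(* The corner A_p consists of the a with rho(a) = p rho(a) p, so it is a
   hereditary subalgebra, monotone in p; this gives one inclusion. For the other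
   one, let B be the hereditary subalgebra generated by the A_{p_n}. As A is
   separable, B has a strictly positive element h, and 1 - (1 - rho(h))^n tends
   strongly to the projection q onto the orthogonal complement of the common
   kernel of rho(B). An open p_n is a limit of elements of A_{p_n}, so p_n <= q
   and hence p <= q. Let a be in A_p. The vector of a state vanishing on B is
   killed by q, hence by p, so that state vanishes at a^* a. By Hahn-Banach,
   a^* a <= e + b for some b in B and arbitrarily small e, which makes a - a f
   small for a suitable f in B. The same holds for a^*, and B A B lies in B by
   heredity, so a is in B.

   The states come from a Hahn-Banach functional, which is positive because
   -x^* x is dominated by 0 in the unitization (Kaplansky); this follows from the
   C*-identity and square roots, obtained by iterating s |-> (k + s^2) / 2. *)

Set Implicit Arguments.
Unset Strict Implicit.
Unset Printing Implicit Defensive.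

Import Order.TTheory GRing.Theory Num.Theory.
Import numFieldNormedType.Exports.

Local Open Scope classical_set_scope.
Local Open Scope complex_scope.
Local Open Scope ring_scope.

Local Notation "a ** b" := (cmul a b) (at level 40, left associativity).
Local Notation "a ^#" := (cstar a) (at level 2, format "a ^#").

(** * Real sequences and complex normed spaces *)

(** [A] need not have a unit, and positivity means being of the form x^* x, so neither spectra nor a
    workable order is available at the start. For self-adjoint c, the inequality c <= t is therefore
    written as a norm estimate: for some r >= 0, the operator r + c, acting on [A] by
    multiplication, has norm at most r + t. Such estimates add up, and they survive limits as long
    as r stays fixed. They are transported by growth of powers. If G is self-adjoint, the norms of
    G^n b form a log-convex sequence, so a bound C t^n for all n forces norm (G b) <= t norm b. This
    does the work of the spectral radius twice: in comparing y y^* with y^* y, and in passing from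
    [A] to the universal representation. The error a - a f is estimated on vectors, but is wanted
    small in the norm of [A]. So [rho] has to be shown isometric, which again rests on the existence
    of enough states. *)

Lemma Re_normr_ge0 {R : rcfType} (z : R[i]) : 0 <= complex.Re `|z|.
Proof. by rewrite -ler0c (RRe_real (normr_real z)) normr_ge0. Qed.

Section Norm.
Context {R : realType} {V : normedModType R[i]}.
Implicit Types (x y z : V) (e : R).

(** The norm of [V] takes its values in [R[i]]; its real part carries the same information in the
    ordered field [R], where infima, square roots and linear arithmetic apply. *)
Definition nrm x : R := complex.Re `|x|.

Lemma nrmE x : `|x| = (nrm x)%:C.
Proof. by rewrite /nrm RRe_real// normr_real. Qed.

Lemma nrm_ge0 x : 0 <= nrm x.
Proof. by rewrite -ler0c -nrmE. Qed.

Lemma nrm0 : nrm 0 = 0.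
Proof. by rewrite /nrm normr0. Qed.

Lemma nrm0_eq0 x : nrm x = 0 -> x = 0.
Proof. by move=> x0; apply/normr0_eq0; rewrite nrmE x0. Qed.

Lemma nrmN x : nrm (- x) = nrm x.
Proof. by rewrite /nrm normrN. Qed.

Lemma nrmD x y : nrm (x + y) <= nrm x + nrm y.
Proof. by rewrite -lecR rmorphD/= -!nrmE ler_normD. Qed.

Lemma nrmBC x y : nrm (x - y) = nrm (y - x).
Proof. by rewrite /nrm distrC. Qed.

Lemma nrmB x y : nrm (x - y) <= nrm x + nrm y.
Proof. by rewrite -(nrmN y) nrmD. Qed.

Lemma nrm_triangle y x z : nrm (x - z) <= nrm (x - y) + nrm (y - z).
Proof. by rewrite -[x - z](subrKA y) nrmD. Qed.

Lemma nrmZ (c : R[i]) x : nrm (c *: x) = complex.Re `|c| * nrm x.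
Proof.
by apply: complexI; rewrite rmorphM/= (RRe_real (normr_real c)) -!nrmE normrZ.
Qed.

Lemma nrmZr (r : R) x : nrm (r%:C *: x) = `|r| * nrm x.
Proof. by rewrite nrmZ normc_def/= expr0n/= addr0 sqrtr_sqr. Qed.

Lemma nrmZp (r : R) x : 0 <= r -> nrm (r%:C *: x) = r * nrm x.
Proof. by move=> r0; rewrite nrmZr ger0_norm. Qed.

Lemma nrm_le0 x : (forall e, 0 < e -> nrm x <= e) -> x = 0.
Proof.
move=> H; apply: nrm0_eq0; apply/eqP; rewrite eq_le nrm_ge0 andbT.
by apply/ler_addgt0Pl => e e0; rewrite addr0 H.
Qed.

Lemma nbhs_nrm x (P : set V) :
  nbhs x P <-> exists2 e, 0 < e & forall y, nrm (x - y) < e -> P y.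
Proof.
split=> [/nbhs_normP[e /= e0 H]|[e e0 H]].
  have eE : e = (complex.Re e)%:C by rewrite RRe_real// gtr0_real.
  exists (complex.Re e); first by rewrite -ltcR -eE.
  by move=> y xy; apply: H => /=; rewrite nrmE eE ltcR.
apply/nbhs_normP; exists e%:C => /=; first by rewrite ltcR.
by move=> y /=; rewrite nrmE ltcR; exact: H.
Qed.

Lemma closed_nrmP (W : set V) :
  closed W <->
  forall x, (forall e, 0 < e -> exists2 w, W w & nrm (x - w) < e) -> W x.
Proof.
split=> [cW x H|H x Wx].
  apply: cW => B /nbhs_nrm[e e0 HB]; have [w Ww xw] := H e e0.
  by exists w; split=> //; exact: HB.
apply: H => e e0; have [|w [Ww xw]] := Wx [set y | nrm (x - y) < e].
  by apply/nbhs_nrm; exists e.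
by exists w.
Qed.

End Norm.

Section Complete.
Context {R : realType} {V : completeNormedModType R[i]}.

Lemma nrm_complete (u : nat -> V) :
  (forall e : R, 0 < e -> exists N, forall n m, (N <= n)%N -> (N <= m)%N ->
     nrm (u n - u m) < e) ->
  exists l, forall e : R, 0 < e -> exists N, forall n, (N <= n)%N ->
     nrm (l - u n) < e.
Proof.
move=> H; have /cauchy_cvgP cu : cauchy (u @ \oo).
  apply: cauchy_exP => e e0; have eE : e = (complex.Re e)%:C.
    by rewrite RRe_real// gtr0_real.
  have [|N HN] := H (complex.Re e); first by rewrite -ltcR -eE.
  exists (u N); exists N => // m /= Nm.
  by rewrite -ball_normE /= nrmE eE ltcR; apply: HN.
have /cvg_ex[l ul] := cu.
exists l => e e0; have /(_ [set y | nrm (l - y) < e]) := ul.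
by case=> [|N _ HN]; [apply/nbhs_nrm; exists e|exists N => n Nn; exact: HN].
Qed.

End Complete.

Section RealSequences.
Context {R : realType}.
Implicit Types (x y C t : R) (g : nat -> R).

Lemma bernoulli x n : 0 <= x -> 1 + n%:R * x <= (1 + x) ^+ n.
Proof.
move=> x0; elim: n => [|n IH]; first by rewrite mul0r addr0 expr0.
rewrite exprS; apply: le_trans (_ : (1 + x) * (1 + n%:R * x) <= _); last first.
  by rewrite ler_wpM2l// addr_ge0.
have n0 : 0 <= n%:R :> R by []; rewrite -natr1; nra.
Qed.

Lemma exists_natM_gt x y : 0 < x -> exists n, y < n%:R * x.
Proof.
move=> x0; exists (Num.bound `|y / x|).
rewrite -ltr_pdivrMr//.
exact: le_lt_trans (ler_norm _) (archi_boundP (normr_ge0 _)).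
Qed.

Lemma geometric_small t C e : 0 <= t < 1 -> 0 <= C -> 0 < e ->
  exists n, C * t ^+ n < e.
Proof.
move=> /andP[t0 t1] C0 e0; have [->|tn0] := eqVneq t 0.
  by exists 1%N; rewrite expr1 mulr0.
have tp : 0 < t by rewrite lt0r tn0.
have s0 : 0 < t^-1 - 1 by rewrite subr_gt0 invf_gt1.
have [n Hn] := exists_natM_gt (C / e) s0; exists n.
have := bernoulli n (ltW s0); have -> : 1 + (t^-1 - 1) = t^-1 by lra.
move=> Hb.
have : C / e < t^-1 ^+ n by lra.
by rewrite ltr_pdivrMr// exprVn mulrC ltr_pdivlMr// exprn_gt0.
Qed.

Lemma le_of_exprM_le x y C c : 0 <= x -> 0 <= y -> 0 < c ->
  (forall n, c * x ^+ n <= C * y ^+ n) -> x <= y.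
Proof.
move=> x0 y0 c0 H; rewrite leNgt; apply/negP => yx.
have xp : 0 < x by exact: le_lt_trans yx.
have C0 : 0 < C by have := H 0%N; rewrite !expr0; lra.
have [|n] := @geometric_small (y / x) C c _ (ltW C0) c0.
  by rewrite divr_ge0//= ltr_pdivrMr// mul1r.
by rewrite expr_div_n mulrA ltr_pdivrMr ?exprn_gt0// ltNge H.
Qed.

(** Log-convexity makes the ratios [g n.+1 / g n] nondecreasing, so the first one cannot exceed the
    growth rate [t], however large [C] is. *)
Lemma log_convex_le g C t : 0 <= t -> (forall n, 0 <= g n) ->
  (forall n, g n.+1 ^+ 2 <= g n * g n.+2) -> (forall n, g n <= C * t ^+ n) ->
  g 1%N <= t * g 0%N.
Proof.
move=> t0 g0 gc gC; have [g00|g0n] := eqVneq (g 0%N) 0.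
  have := gc 0%N; rewrite g00 mul0r mulr0.
  by have := g0 1%N; nra.
have g0p : 0 < g 0%N by rewrite lt0r g0n g0.
have incr n : g 1%N * g n <= g 0%N * g n.+1.
  elim: n => [|n IH]; first by rewrite mulrC.
  have [-> |gn] := eqVneq (g n.+1) 0.
    by rewrite mulr0 mulr_ge0.
  have gp : 0 < g n.+1 by rewrite lt0r gn g0.
  rewrite -(ler_pM2r gp); apply: le_trans (_ : g 1%N * (g n * g n.+2) <= _).
    by rewrite -mulrA -expr2 ler_wpM2l.
  by rewrite mulrA [leRHS]mulrAC ler_wpM2r.
rewrite -ler_pdivrMr//; apply: (@le_of_exprM_le _ _ C (g 0%N)) => //.
  by rewrite divr_ge0.
move=> n; apply: le_trans (gC n).
elim: n => [|n IH]; first by rewrite expr0 mulr1.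
rewrite exprS mulrCA; apply: le_trans (_ : g 1%N / g 0%N * g n <= _).
  by rewrite ler_wpM2l// divr_ge0.
by rewrite mulrAC ler_pdivrMr// [leRHS]mulrC.
Qed.

End RealSequences.

Lemma nrm_geometric_lim {R : realType} {V : completeNormedModType R[i]}
    (u : nat -> V) (C t : R) : 0 <= C -> 0 <= t < 1 ->
  (forall n, nrm (u n.+1 - u n) <= C * t ^+ n) ->
  exists l, forall n, nrm (l - u n) <= C / (1 - t) * t ^+ n.
Proof.
move=> C0 /andP[t0 t1] H.
have s0 : 0 < 1 - t by rewrite subr_gt0.
set K := C / (1 - t); have K0 : 0 <= K by rewrite divr_ge0// ltW.
have KE : C = K * (1 - t) by rewrite /K divfK// gt_eqF.
have tail n k : nrm (u (n + k)%N - u n) <= K * t ^+ n.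
  have : nrm (u (n + k)%N - u n) <= K * (t ^+ n - t ^+ (n + k)).
    elim: k => [|k IH]; first by rewrite addn0 !subrr nrm0 mulr0.
    apply: le_trans (nrm_triangle (u (n + k)%N) _ _) _.
    rewrite addnS; have := H (n + k)%N; rewrite exprS KE; nra.
  have : 0 <= t ^+ (n + k) by rewrite exprn_ge0.
  nra.
have tail2 n m : (n <= m)%N -> nrm (u m - u n) <= K * t ^+ n.
  by move=> /subnKC <-; exact: tail.
have [|l Hl] := @nrm_complete R V u.
  move=> e e0; have e2 : 0 < e / 2 by rewrite divr_gt0.
  have [|N HN] := @geometric_small R t K (e / 2) _ K0 e2; first by rewrite t0.
  exists N => n m Nn Nm; apply: le_lt_trans (nrm_triangle (u N) _ _) _.
  by have := tail2 _ _ Nn; have := tail2 _ _ Nm; rewrite (nrmBC (u N)); lra.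
exists l => n; apply/ler_addgt0Pl => e e0; have [N HN] := Hl e e0.
apply: le_trans (nrm_triangle (u (maxn n N)) _ _) _.
apply: lerD; first by rewrite ltW// HN// leq_maxr.
by rewrite tail2// leq_maxl.
Qed.

(** * Dominated extension *)

Lemma scalar_eq0 {K : pzRingType} {V : lmodType K} (phi : V -> K) :
  scalar phi -> phi 0 = 0.
Proof.
by move=> l; have := l (-1) 0 0; rewrite scaler0 addr0 mulN1r addNr.
Qed.

Lemma scalar_mul {K : pzRingType} {V : lmodType K} (phi : V -> K) k v :
  scalar phi -> phi (k *: v) = k * phi v.
Proof. by move=> l; have := l k v 0; rewrite (scalar_eq0 l) !addr0. Qed.

Lemma linear_eq0 {K : pzRingType} {V W : lmodType K} (T : V -> W) :
  linear T -> T 0 = 0.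
Proof.
by move=> l; have := l (-1) 0 0; rewrite scaler0 addr0 scaleN1r addNr.
Qed.

Lemma linear_scale {K : pzRingType} {V W : lmodType K} (T : V -> W) k v :
  linear T -> T (k *: v) = k *: T v.
Proof. by move=> l; have := l k v 0; rewrite (linear_eq0 l) !addr0. Qed.

Lemma linear_sub {K : pzRingType} {V W : lmodType K} (T : V -> W) u v :
  linear T -> T (u - v) = T u - T v.
Proof. by move=> l; rewrite addrC -scaleN1r l scaleN1r addrC. Qed.

Section HahnBanach.
Context {R : realType} {V : lmodType R[i]}.
Implicit Types (p q f : V -> R) (x y v : V).

(** Inequality in the second clause suffices: applied to 1/r it gives the converse ([sublinearZ]).
    It is what infima satisfy most directly. *)
Definition sublinear p :=
  (forall x y, p (x + y) <= p x + p y) /\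
  (forall (r : R) x, 0 < r -> p (r%:C *: x) <= r * p x).

Lemma real_scaleVK (r : R) x : r != 0 -> r^-1%:C *: (r%:C *: x) = x.
Proof. by move=> r0; rewrite scalerA -rmorphM/= mulVf// scale1r. Qed.

Lemma sublinearZ p r x : sublinear p -> 0 < r -> p (r%:C *: x) = r * p x.
Proof.
move=> [_ pZ] r0; apply/eqP; rewrite eq_le pZ//= -ler_pdivlMl//.
by rewrite -[in p x](@real_scaleVK r x) ?gt_eqF// pZ// invr_gt0.
Qed.

Lemma sublinear0 p : sublinear p -> p 0 = 0.
Proof.
move=> sp; have := sublinearZ 0 sp (ltr0n R 2); rewrite scaler0; lra.
Qed.

Lemma sublinearN p x : sublinear p -> - p (- x) <= p x.
Proof.
move=> sp; have := sp.1 x (- x); rewrite subrr (sublinear0 sp); lra.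
Qed.

Lemma sublinear_inf (S : V -> set R) :
  (forall x, S x !=set0) -> (forall x, has_lbound (S x)) ->
  (forall x y s t, S x s -> S y t -> exists2 u, S (x + y) u & u <= s + t) ->
  (forall r x s, 0 < r -> S x s -> exists2 u, S (r%:C *: x) u & u <= r * s) ->
  sublinear (fun x => inf (S x)).
Proof.
move=> S0 Sb SD SZ; have hi x : has_inf (S x) by split.
split=> [x y|r x r0]; apply/ler_addgt0Pl => e e0.
- have e2 : 0 < e / 2 by rewrite divr_gt0.
  have [s Ss sx] := inf_adherent e2 (hi x).
  have [t St ty] := inf_adherent e2 (hi y).
  have [u Su ust] := SD _ _ _ _ Ss St.
  by have := ge_inf (Sb _) Su; lra.
- have e2 : 0 < e / r by rewrite divr_gt0.
  have [s Ss sx] := inf_adherent e2 (hi x).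
  have [u Su us] := SZ _ _ _ r0 Ss.
  apply: le_trans (ge_inf (Sb _) Su) _; apply: le_trans us _.
  rewrite -ler_pdivlMl// mulrDr mulKf ?gt_eqF//.
  by rewrite mulrC addrC; exact: ltW.
Qed.

(** [q x] is the infimum of p (x + t v) - t p v over t >= 0. At x = - v the last bound reads q (- v)
    <= - p v, so a linear functional below [q] must agree with [p] at [v]. *)
Lemma sublinear_slope p v : sublinear p ->
  exists q, [/\ sublinear q, forall x, q x <= p x &
    forall x, q x <= p (x + v) - p v].
Proof.
move=> sp.
pose S x := [set p (x + t%:C *: v) - t * p v | t in [set t : R | 0 <= t]].
have pt t : 0 <= t -> p (t%:C *: v) = t * p v.
  rewrite le_eqVlt => /predU1P[<-|t0]; last by rewrite sublinearZ.
  by rewrite scale0r mul0r sublinear0.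
have Sb x : has_lbound (S x).
  exists (- p (- x)) => _ [t /= t0 <-].
  have := sp.1 (x + t%:C *: v) (- x); rewrite addrAC subrr add0r pt//; lra.
exists (fun x => inf (S x)); split.
- apply: sublinear_inf => //.
  + by move=> x; exists (p (x + 0%:C *: v) - 0 * p v); exists 0 => /=.
  + move=> x y _ _ [s /= s0 <-] [t /= t0 <-].
    exists (p (x + y + (s + t)%:C *: v) - (s + t) * p v).
      by exists (s + t) => //=; rewrite addr_ge0.
    have := sp.1 (x + s%:C *: v) (y + t%:C *: v).
    by rewrite addrACA -scalerDl -rmorphD/=; lra.
  + move=> r x _ r0 [t /= t0 <-].
    exists (p (r%:C *: x + (r * t)%:C *: v) - (r * t) * p v).
      by exists (r * t) => //=; rewrite mulr_ge0// ltW.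
    by rewrite rmorphM/= -scalerA -scalerDr sublinearZ// mulrBr mulrA.
- move=> x; apply: le_trans (_ : p (x + 0%:C *: v) - 0 * p v <= _).
    by apply: ge_inf => //; exists 0 => /=.
  by rewrite scale0r mul0r addr0 subr0.
- move=> x; apply: le_trans (_ : p (x + 1%:C *: v) - 1 * p v <= _).
    by apply: ge_inf => //; exists 1 => /=.
  by rewrite scale1r mul1r.
Qed.

Lemma sublinear_minimal p : sublinear p -> exists q,
  [/\ sublinear q, forall x, q x <= p x &
    forall q', sublinear q' -> (forall x, q' x <= q x) -> q' = q].
Proof.
move=> sp; pose T := {q | sublinear q /\ forall x, q x <= p x}.
(* The order is reversed, so that the maximal element from Zorn's lemma is a minimal functional. *)
pose le (q q' : T) := `[< forall x, sval q' x <= sval q x >].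
have lerefl (q : T) : le q q by apply/asboolP.
have letrans (q r s : T) : le q r -> le r s -> le q s.
  move=> /asboolP qr /asboolP rs; apply/asboolP => x.
  exact: le_trans (rs x) (qr x).
have leanti (q r : T) : le q r -> le r q -> q = r.
  case: q r => [q sq] [r sr] /asboolP/= qr /asboolP/= rq; apply: eq_exist.
  by apply/funext => x; apply/le_anti; rewrite qr rq.
have chain (A : set T) : total_on A le ->
    exists t, forall s, A s -> le s t.
  (* The empty chain is bounded by [p] itself; an infimum over it would be meaningless. *)
  move=> tA; have [[q0 Aq0]|A0] := pselect (A !=set0); last first.
    by exists (exist _ p (conj sp (fun=> lexx _))) => s As; case: A0; exists s.
  pose S x := [set sval q x | q in A].
  have Sb x : has_lbound (S x).
    exists (- p (- x)) => _ [[q [sq qp]] _ <-] /=.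
    apply: le_trans (sublinearN _ sq); by rewrite lerN2.
  have sS : sublinear (fun x => inf (S x)).
    apply: sublinear_inf => //.
    - by move=> x; exists (sval q0 x); exists q0.
    - move=> x y _ _ [q Aq <-] [r Ar <-].
      have [/asboolP qr|/asboolP rq] := tA q r Aq Ar.
      + exists (sval r (x + y)); first by exists r.
        apply: le_trans ((svalP r).1.1 _ _) _; by rewrite lerD2r.
      + exists (sval q (x + y)); first by exists q.
        apply: le_trans ((svalP q).1.1 _ _) _; by rewrite lerD2l.
    - move=> r x _ r0 [q Aq <-].
      exists (sval q (r%:C *: x)); first by exists q.
      exact: (svalP q).1.2.
  have Sp x : inf (S x) <= p x.
    apply: le_trans ((svalP q0).2 x); apply: ge_inf => //; by exists q0.
  exists (exist _ (fun x => inf (S x)) (conj sS Sp)) => s As; apply/asboolP => x /=.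
  by apply: ge_inf => //; exists s.
have [[q [sq qp]] qmax] := Zorn lerefl letrans leanti chain.
exists q; split=> // q' sq' q'q.
have q'p x : q' x <= p x by exact: le_trans (q'q x) (qp x).
suff : exist _ q' (conj sq' q'p) = exist _ q (conj sq qp) :> T by case.
by apply: qmax; apply/asboolP.
Qed.

(* A minimal sublinear functional is additive, since otherwise its slope in
   some direction would be a strictly smaller one. *)
Lemma hahn_banach p v : sublinear p -> exists f,
  [/\ forall x y, f (x + y) = f x + f y,
      forall (r : R) x, f (r%:C *: x) = r * f x,
      forall x, f x <= p x & f v = p v].
Proof.
move=> sp; have [p1 [sp1 p1p p1v]] := sublinear_slope v sp.
have [f [sf fp1 fmin]] := sublinear_minimal sp1.
have fD x y : f (x + y) = f x + f y.
  apply/eqP; rewrite eq_le sf.1/=.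
  have [q [sq qf qfy]] := sublinear_slope y sf.
  by have := qfy x; rewrite (fmin _ sq qf); lra.
have fN x : f (- x) = - f x.
  by have := fD x (- x); rewrite subrr (sublinear0 sf); lra.
exists f; split=> //.
- move=> r x; have [r0|r0|<-] := ltgtP 0 r.
  + by rewrite sublinearZ.
  + rewrite -[r in LHS]opprK rmorphN/= scaleNr fN sublinearZ ?oppr_gt0//.
    by rewrite mulNr opprK.
  + by rewrite scale0r mul0r sublinear0.
- by move=> x; exact: le_trans (fp1 x) (p1p x).
- apply/eqP; rewrite eq_le (le_trans (fp1 v))//=.
  have := le_trans (fp1 (- v)) (p1v (- v)).
  by rewrite addNr (sublinear0 sp) fN; lra.
Qed.

End HahnBanach.

(** * Adjointable operators on a C*-algebra *)

Section CStarNorm.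
Context {R : realType} {A : cstarAlgType R}.
Implicit Types (a b c : A).

Lemma cmulDl a b c : (a + b) ** c = a ** c + b ** c.
Proof. exact: linearDl. Qed.

Lemma cmulDr a b c : a ** (b + c) = a ** b + a ** c.
Proof. exact: linearDr. Qed.

Lemma cmulBl a b c : (a - b) ** c = a ** c - b ** c.
Proof. exact: linearBl. Qed.

Lemma cmulBr a b c : a ** (b - c) = a ** b - a ** c.
Proof. exact: linearBr. Qed.

Lemma cmulNl a b : (- a) ** b = - (a ** b).
Proof. exact: linearNl. Qed.

Lemma cmulNr a b : a ** (- b) = - (a ** b).
Proof. exact: linearNr. Qed.

Lemma cmulZl (k : R[i]) a b : (k *: a) ** b = k *: (a ** b).
Proof. exact: linearZl_LR. Qed.

Lemma cmulZr (k : R[i]) a b : a ** (k *: b) = k *: (a ** b).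
Proof. exact: linearZr_LR. Qed.

Lemma cmul0l a : 0 ** a = 0.
Proof. exact: linear0l. Qed.

Lemma cstarP (k : R[i]) a b : (k *: a + b)^# = k^*%C *: a^# + b^#.
Proof. exact: cstar_antilinear. Qed.

Lemma cstarD a b : (a + b)^# = a^# + b^#.
Proof. by have := cstarP 1 a b; rewrite conjc1 !scale1r. Qed.

Lemma cstar0 : (0 : A)^# = 0.
Proof. by apply: (addIr (0 : A)^#); rewrite -cstarD !add0r. Qed.

Lemma cstarZ (k : R[i]) a : (k *: a)^# = k^*%C *: a^#.
Proof. by have := cstarP k a 0; rewrite cstar0 !addr0. Qed.

Lemma cstarN a : (- a)^# = - a^#.
Proof. by rewrite -scaleN1r cstarZ rmorphN1 scaleN1r. Qed.

Lemma cstarB a b : (a - b)^# = a^# - b^#.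
Proof. by rewrite cstarD cstarN. Qed.

Lemma cstarZr (r : R) a : (r%:C *: a)^# = r%:C *: a^#.
Proof. by rewrite cstarZ conjc_real. Qed.

Lemma nrmM a b : nrm (a ** b) <= nrm a * nrm b.
Proof. by rewrite -lecR rmorphM/= -!nrmE cnormM. Qed.

Lemma nrm_starM a : nrm (a^# ** a) = nrm a ^+ 2.
Proof. by apply: complexI; rewrite rmorphXn/= -!nrmE cnorm_star. Qed.

Lemma nrm_star a : nrm a^# = nrm a.
Proof.
have H b : nrm b <= nrm b^#.
  have := nrmM b^# b; rewrite nrm_starM expr2.
  have [-> //|b0] := eqVneq (nrm b) 0; first by rewrite nrm_ge0.
  by rewrite ler_pM2r// lt0r b0 nrm_ge0.
by apply/eqP; rewrite eq_le H andbT; have := H a^#; rewrite cstarK.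
Qed.

Lemma cstarM_eq0 a : a^# ** a = 0 -> a = 0.
Proof.
move=> a0; apply: nrm0_eq0; apply/eqP.
by rewrite -[_ == _](sqrf_eq0 (nrm a)) -nrm_starM a0 nrm0.
Qed.

(** No unit is there to be multiplied with; instead c = a - b is taken, and the C*-identity
    applies. *)
Lemma cmul_extl a b : (forall c, c^# ** a = c^# ** b) -> a = b.
Proof.
move=> H; apply/eqP; rewrite -subr_eq0; apply/eqP/cstarM_eq0.
by rewrite cmulBr H subrr.
Qed.

Lemma cmul_extr a b : (forall c, a^# ** c = b^# ** c) -> a = b.
Proof.
move=> H; apply/eqP; rewrite -subr_eq0; apply/eqP/cstarM_eq0.
by rewrite cstarB cmulBl H subrr.
Qed.

Lemma conj_i : 'i%C^*%C = - 'i%C :> R[i].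
Proof. by apply/eqP; rewrite eq_complex /= oppr0 !eqxx. Qed.

Lemma cartesian a :
  a = 2^-1%:C *: ((a + a^#) - 'i%C *: ('i%C *: (a - a^#))).
Proof.
rewrite scalerA -expr2 sqr_i scaleN1r opprK addrACA subrr addr0.
rewrite scalerDr -scalerDl -rmorphD/= (_ : 2^-1 + 2^-1 = 1 :> R); last lra.
by rewrite scale1r.
Qed.

Lemma cartesian_re a : (a + a^#)^# = a + a^#.
Proof. by rewrite cstarD cstarK addrC. Qed.

Lemma cartesian_im a : ('i%C *: (a - a^#))^# = 'i%C *: (a - a^#).
Proof. by rewrite cstarZ cstarB cstarK conj_i scaleNr -scalerN opprB. Qed.

End CStarNorm.

Section AdjointableOperators.
Context {R : realType} {A : cstarAlgType R}.

(* Acting on A by multiplication, a (possibly non-unital) A sits inside the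
   unital algebra of bounded adjointable operators of A. *)
Record lop := Lop {
  lfun :> A -> A ;
  ladj : A -> A ;
  lopP : forall b c, (lfun b)^# ** c = b^# ** ladj c ;
  lop_bounded : exists C : R, forall b, nrm (lfun b) <= C * nrm b }.

Implicit Types (S T : lop) (b c : A).

Lemma lop_adjP T b c : (ladj T b)^# ** c = b^# ** T c.
Proof. by rewrite -[LHS]cstarK cstarM cstarK -lopP cstarM !cstarK. Qed.

Lemma lop_ext S T : (forall b, S b = T b) -> S = T.
Proof.
case: S T => [f f' fP fb] [g g' gP gb] /= /funext fg; move: gP gb; rewrite -fg.
move=> gP gb; have fg' : f' = g'.
  by apply/funext => c; apply: cmul_extl => b; rewrite -fP gP.
move: gP; rewrite -fg' => gP.
by rewrite (Prop_irrelevance fP gP) (Prop_irrelevance fb gb).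
Qed.

(** Linearity is not a field of [lop] because having an adjoint already forces it. *)
Lemma lop_linear T : linear T.
Proof.
move=> k b c; apply: cmul_extr => d.
by rewrite lopP !cstarD !cmulDl !cstarZ !cmulZl !lopP.
Qed.

Lemma lopZ T (k : R[i]) b : T (k *: b) = k *: T b.
Proof. exact: linear_scale (lop_linear T). Qed.

Lemma lopD T b c : T (b + c) = T b + T c.
Proof. by have := lop_linear T 1 b c; rewrite !scale1r. Qed.

(** Cauchy-Schwarz for the [A]-valued inner product b^* c, with respect to which [ladj T] is the
    adjoint of [T]. *)
Lemma lop_sqr T b : nrm (T b) ^+ 2 <= nrm b * nrm (ladj T (T b)).
Proof.
by rewrite -nrm_starM lopP; apply: le_trans (nrmM _ _) _; rewrite nrm_star.
Qed.

Lemma lop_bounded_ge0 T :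
  exists2 C : R, 0 <= C & forall b, nrm (T b) <= C * nrm b.
Proof.
have [C HC] := lop_bounded T; exists `|C| => // b; apply: le_trans (HC b) _.
by rewrite ler_wpM2r ?nrm_ge0// ler_norm.
Qed.

Lemma ladj_bound T (C : R) : 0 <= C -> (forall b, nrm (T b) <= C * nrm b) ->
  forall b, nrm (ladj T b) <= C * nrm b.
Proof.
move=> C0 HC b; have [-> |Tb0] := eqVneq (nrm (ladj T b)) 0.
  by rewrite mulr_ge0 ?nrm_ge0.
have Tbp : 0 < nrm (ladj T b) by rewrite lt0r Tb0 nrm_ge0.
have : nrm (ladj T b) ^+ 2 <= nrm b * nrm (T (ladj T b)).
  rewrite -nrm_starM lop_adjP; apply: le_trans (nrmM _ _) _.
  by rewrite nrm_star.
move=> H; rewrite -(ler_pM2r Tbp) -expr2; apply: le_trans H _.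
by rewrite mulrC mulrAC ler_wpM2r ?nrm_ge0// HC.
Qed.

Definition lstar T : lop :=
  Lop (lop_adjP T) (let: ex_intro2 C C0 HC := lop_bounded_ge0 T in
                    ex_intro _ C (ladj_bound C0 HC)).

Lemma ladd_subproof1 S T b c :
  (S b + T b)^# ** c = b^# ** (ladj S c + ladj T c).
Proof. by rewrite cstarD cmulDl cmulDr !lopP. Qed.

Lemma ladd_subproof2 S T :
  exists C : R, forall b, nrm (S b + T b) <= C * nrm b.
Proof.
have [C HC] := lop_bounded S; have [D HD] := lop_bounded T.
exists (C + D) => b; apply: le_trans (nrmD _ _) _.
by rewrite mulrDl lerD.
Qed.

Lemma lscale_subproof1 (k : R[i]) T b c :
  (k *: T b)^# ** c = b^# ** (k^*%C *: ladj T c).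
Proof. by rewrite cstarZ cmulZl cmulZr lopP. Qed.

Lemma lscale_subproof2 (k : R[i]) T :
  exists C : R, forall b, nrm (k *: T b) <= C * nrm b.
Proof.
have [C HC] := lop_bounded T; exists (complex.Re `|k| * C) => b.
by rewrite nrmZ -mulrA ler_wpM2l// Re_normr_ge0.
Qed.

Lemma lmul_subproof1 S T b c :
  (S (T b))^# ** c = b^# ** ladj T (ladj S c).
Proof. by rewrite !lopP. Qed.

Lemma lmul_subproof2 S T :
  exists C : R, forall b, nrm (S (T b)) <= C * nrm b.
Proof.
have [C C0 HC] := lop_bounded_ge0 S; have [D HD] := lop_bounded T.
exists (C * D) => b; apply: le_trans (HC _) _.
by rewrite -mulrA ler_wpM2l.
Qed.

Lemma lid_subproof : exists C : R, forall b : A, nrm b <= C * nrm b.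
Proof. by exists 1 => b; rewrite mul1r. Qed.

Definition ladd S T : lop := Lop (ladd_subproof1 S T) (ladd_subproof2 S T).
Definition lscale k T : lop := Lop (lscale_subproof1 k T) (lscale_subproof2 k T).
Definition lmul S T : lop := Lop (lmul_subproof1 S T) (lmul_subproof2 S T).
Definition lid : lop := @Lop id id (fun _ _ => erefl) lid_subproof.

HB.instance Definition _ := gen_eqMixin lop.
HB.instance Definition _ := gen_choiceMixin lop.

Lemma laddA : associative ladd.
Proof. by move=> S T U; apply: lop_ext => b /=; rewrite addrA. Qed.
Lemma laddC : commutative ladd.
Proof. by move=> S T; apply: lop_ext => b /=; rewrite addrC. Qed.
Lemma ladd0 : left_id (lscale 0 lid) ladd.
Proof. by move=> S; apply: lop_ext => b /=; rewrite scale0r add0r. Qed.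
Lemma laddN : left_inverse (lscale 0 lid) (lscale (-1)) ladd.
Proof. by move=> S; apply: lop_ext => b /=; rewrite scale0r scaleN1r addNr. Qed.

HB.instance Definition _ := GRing.isZmodule.Build lop laddA laddC ladd0 laddN.

Lemma lmulA : associative lmul.
Proof. by move=> S T U; apply: lop_ext. Qed.
Lemma lmul1l : left_id lid lmul.
Proof. by move=> S; apply: lop_ext. Qed.
Lemma lmul1r : right_id lid lmul.
Proof. by move=> S; apply: lop_ext. Qed.
Lemma lmulDl : left_distributive lmul +%R.
Proof. by move=> S T U; apply: lop_ext. Qed.
Lemma lmulDr : right_distributive lmul +%R.
Proof. by move=> S T U; apply: lop_ext => b /=; rewrite lopD. Qed.

HB.instance Definition _ :=
  GRing.Zmodule_isPzRing.Build lop lmulA lmul1l lmul1r lmulDl lmulDr.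

Lemma lscaleA k l T : lscale k (lscale l T) = lscale (k * l) T.
Proof. by apply: lop_ext => c /=; rewrite scalerA. Qed.
Lemma lscale1 : left_id 1 lscale.
Proof. by move=> S; apply: lop_ext => b /=; rewrite scale1r. Qed.
Lemma lscaleDr : right_distributive lscale +%R.
Proof. by move=> k S T; apply: lop_ext => b /=; rewrite scalerDr. Qed.
Lemma lscaleDl T : {morph lscale^~ T : k l / k + l}.
Proof. by move=> k l; apply: lop_ext => b /=; rewrite scalerDl. Qed.

HB.instance Definition _ :=
  GRing.Zmodule_isLmodule.Build R[i] lop lscaleA lscale1 lscaleDr lscaleDl.

Lemma lscaleAl (k : R[i]) S T : (k *: S) * T = k *: (S * T).
Proof. exact: lop_ext. Qed.

Lemma lscaleAr (k : R[i]) S T : S * (k *: T) = k *: (S * T).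
Proof. by apply: lop_ext => b /=; rewrite lopZ. Qed.

Lemma laddE S T b : (S + T) b = S b + T b. Proof. by []. Qed.
Lemma lmulE S T b : (S * T) b = S (T b). Proof. by []. Qed.
Lemma lscaleE (k : R[i]) T b : (k *: T) b = k *: T b. Proof. by []. Qed.
Lemma loppE T b : (- T) b = - T b. Proof. exact: scaleN1r. Qed.
Lemma lsubE S T b : (S - T) b = S b - T b. Proof. by rewrite laddE loppE. Qed.

Lemma lstarK : involutive lstar. Proof. by move=> T; apply: lop_ext. Qed.
Lemma lstarD S T : lstar (S + T) = lstar S + lstar T.
Proof. exact: lop_ext. Qed.
Lemma lstarM S T : lstar (S * T) = lstar T * lstar S.
Proof. exact: lop_ext. Qed.
Lemma lstarZ k T : lstar (k *: T) = k^*%C *: lstar T.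
Proof. exact: lop_ext. Qed.
Lemma lstarN T : lstar (- T) = - lstar T.
Proof. by rewrite -scaleN1r lstarZ rmorphN1 scaleN1r. Qed.
Lemma lstarB S T : lstar (S - T) = lstar S - lstar T.
Proof. by rewrite lstarD lstarN. Qed.
Lemma lstarZr (r : R) T : lstar (r%:C *: T) = r%:C *: lstar T.
Proof. by rewrite lstarZ conjc_real. Qed.

Definition lconst (r : R) : lop := lscale r%:C lid.

Lemma lconstE r b : lconst r b = r%:C *: b. Proof. by []. Qed.
Lemma lstar_const r : lstar (lconst r) = lconst r.
Proof. by apply: lop_ext => b; rewrite -[LHS]/(r%:C^*%C *: b) conjc_real. Qed.
Lemma lconstD r s : lconst (r + s) = lconst r + lconst s.
Proof. by apply: lop_ext => b /=; rewrite rmorphD/= scalerDl. Qed.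
Lemma lconstM r s : lconst (r * s) = lconst r * lconst s.
Proof. by apply: lop_ext => b /=; rewrite scalerA -rmorphM. Qed.
Lemma lconstN r : lconst (- r) = - lconst r.
Proof. by apply: lop_ext => b /=; rewrite rmorphN/= scaleNr scaleN1r. Qed.
Lemma lconst1 : lconst 1 = 1.
Proof. by apply: lop_ext => b /=; rewrite scale1r. Qed.
Lemma lconst0 : lconst 0 = 0.
Proof. by apply: lop_ext => b /=; rewrite scale0r. Qed.
Lemma lconst_mul r T : lconst r * T = r%:C *: T.
Proof. exact: lop_ext. Qed.
Lemma comm_lconst T r : GRing.comm T (lconst r).
Proof. by apply: lop_ext => b /=; rewrite lopZ. Qed.

Lemma cmul_subproof1 a b c : (a ** b)^# ** c = b^# ** (a^# ** c).
Proof. by rewrite cstarM cmulA. Qed.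
Lemma cmul_subproof2 a : exists C : R, forall b : A, nrm (a ** b) <= C * nrm b.
Proof. by exists (nrm a) => b; exact: nrmM. Qed.

Definition lmult a : lop := Lop (cmul_subproof1 a) (cmul_subproof2 a).

Lemma lmult_star a : lmult a^# = lstar (lmult a).
Proof. exact: lop_ext. Qed.

End AdjointableOperators.
Arguments lop {R} A.

(** * Square roots *)

Section OperatorBounds.
Context {R : realType} {A : cstarAlgType R}.
Implicit Types (S T h k m s u v x y : lop A) (b c : A) (r t e : R).

(** The operator norm enters only through its upper bounds, so no supremum has to be formed. *)
Definition bnd t T := forall b, nrm (T b) <= t * nrm b.

Definition selfadjoint T := lstar T = T.

Lemma bnd_exists T : exists2 t, 0 < t & bnd t T.
Proof.
have [C C0 HC] := lop_bounded_ge0 T; exists (C + 1); first by rewrite ltr_wpDl.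
by move=> b; apply: le_trans (HC b) _; rewrite ler_wpM2r ?nrm_ge0// lerDl.
Qed.

Lemma bnd_le t r T : t <= r -> bnd t T -> bnd r T.
Proof.
by move=> tr H b; apply: le_trans (H b) _; rewrite ler_wpM2r ?nrm_ge0.
Qed.

Lemma bndD r t S T : bnd r S -> bnd t T -> bnd (r + t) (S + T).
Proof.
move=> HS HT b; rewrite laddE mulrDl; apply: le_trans (nrmD _ _) _.
by rewrite lerD.
Qed.

Lemma bndN t T : bnd t T -> bnd t (- T).
Proof. by move=> HT b; rewrite loppE nrmN. Qed.

Lemma bndB r t S T : bnd r S -> bnd t T -> bnd (r + t) (S - T).
Proof. by move=> HS HT; apply: bndD => //; exact: bndN. Qed.

Lemma bndM r t S T : 0 <= r -> bnd r S -> bnd t T -> bnd (r * t) (S * T).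
Proof.
move=> r0 HS HT b; rewrite lmulE; apply: le_trans (HS _) _.
by rewrite -mulrA ler_wpM2l.
Qed.

Lemma bndZ r t T : 0 <= r -> bnd t T -> bnd (r * t) (r%:C *: T).
Proof.
by move=> r0 HT b; rewrite lscaleE nrmZp// -mulrA ler_wpM2l.
Qed.

Lemma bnd_const r : 0 <= r -> bnd r (lconst r).
Proof. by move=> r0 b; rewrite lconstE nrmZp. Qed.

Lemma bnd0 t : 0 <= t -> bnd t 0.
Proof.
by move=> t0 b; rewrite -lconst0 lconstE scale0r nrm0 mulr_ge0 ?nrm_ge0.
Qed.

Lemma bnd_star t T : 0 <= t -> bnd t T -> bnd t (lstar T).
Proof. by move=> t0 HT b; exact: ladj_bound. Qed.

Lemma bndX t T n : 0 <= t -> bnd t T -> bnd (t ^+ n) (T ^+ n).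
Proof.
move=> t0 HT; elim: n => [|n IH]; last by rewrite !exprS; exact: bndM.
by move=> b; rewrite !expr0 mul1r.
Qed.

Lemma bnd_lim t T : (forall e, 0 < e -> bnd (t + e) T) -> bnd t T.
Proof.
move=> H b; apply/ler_addgt0Pl => e e0.
have nb : 0 < nrm b + 1 by rewrite ltr_wpDl// nrm_ge0.
have := H _ (divr_gt0 e0 nb) b; rewrite mulrDl addrC => /le_trans; apply.
rewrite lerD2r mulrAC ler_pdivrMr// ler_wpM2l ?lerDl// ltW//.
Qed.

Lemma bnd_eq0 T : (forall e, 0 < e -> bnd e T) -> T = 0.
Proof.
move=> H; apply: lop_ext => b; rewrite -lconst0 lconstE scale0r.
apply/nrm0_eq0/eqP; rewrite eq_le nrm_ge0 andbT.
have : bnd 0 T by apply: bnd_lim => e e0; rewrite add0r; exact: H.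
by move=> /(_ b); rewrite mul0r.
Qed.

Lemma bnd_geometric_eq0 C t T : 0 <= C -> 0 <= t < 1 ->
  (forall n, bnd (C * t ^+ n) T) -> T = 0.
Proof.
move=> C0 t01 H; apply: bnd_eq0 => e e0.
have [n Hn] := geometric_small t01 C0 e0.
by apply: bnd_le (H n); exact: ltW.
Qed.

Lemma selfadjoint_sqr T b : selfadjoint T ->
  nrm (T b) ^+ 2 <= nrm b * nrm (T (T b)).
Proof. by move=> sT; have := lop_sqr T b; rewrite -[ladj T _]/(lstar T _) sT. Qed.

Lemma selfadjoint_const r : selfadjoint (lconst r).
Proof. exact: lstar_const. Qed.

Lemma selfadjointD S T : selfadjoint S -> selfadjoint T -> selfadjoint (S + T).
Proof. by rewrite /selfadjoint lstarD => -> ->. Qed.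

Lemma selfadjointB S T : selfadjoint S -> selfadjoint T -> selfadjoint (S - T).
Proof. by rewrite /selfadjoint lstarB => -> ->. Qed.

Lemma selfadjointZ r T : selfadjoint T -> selfadjoint (r%:C *: T).
Proof. by rewrite /selfadjoint lstarZr => ->. Qed.

Lemma selfadjointM S T : GRing.comm S T ->
  selfadjoint S -> selfadjoint T -> selfadjoint (S * T).
Proof. by move=> ST; rewrite /selfadjoint lstarM => -> ->. Qed.

Lemma selfadjoint_mul_star T : selfadjoint (T * lstar T).
Proof. by rewrite /selfadjoint lstarM lstarK. Qed.

Lemma selfadjoint_star_mul T : selfadjoint (lstar T * T).
Proof. by rewrite /selfadjoint lstarM lstarK. Qed.

(** The limit must come with an adjoint, so the sequences of operators and of adjoints are both
    followed pointwise; the adjoint relation then passes to the limit. *)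
Lemma lop_complete (w : nat -> lop A) C t : 0 <= C -> 0 <= t < 1 ->
  (forall n, bnd (C * t ^+ n) (w n.+1 - w n)) ->
  exists s, forall n, bnd (C / (1 - t) * t ^+ n) (s - w n).
Proof.
move=> C0 t01 H; have t0 : 0 <= t by case/andP: t01.
have s0 : 0 < 1 - t by rewrite subr_gt0; case/andP: t01.
have [K K0 KE] : exists2 K, 0 <= K & K = C / (1 - t).
  by exists (C / (1 - t)) => //; rewrite divr_ge0// ltW.
have lim (z : nat -> lop A) b : (forall n, bnd (C * t ^+ n) (z n.+1 - z n)) ->
    exists l, forall n, nrm (l - z n b) <= K * t ^+ n * nrm b.
  move=> Hz; have [||n|l Hl] := @nrm_geometric_lim R A (z ^~ b) (C * nrm b) t.
  - by rewrite mulr_ge0 ?nrm_ge0.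
  - by [].
  - by have := Hz n b; rewrite lsubE mulrAC.
  - by exists l => n; have := Hl n; rewrite KE; lra.
have Hs n : bnd (C * t ^+ n) (lstar (w n.+1) - lstar (w n)).
  by rewrite -lstarB; apply: bnd_star; rewrite ?mulr_ge0 ?exprn_ge0.
have /choice[f Hf] := fun b => lim w b H.
have /choice[g Hg] := fun b => lim (fun n => lstar (w n)) b Hs.
have fP b c : (f b)^# ** c = b^# ** g c.
  apply/eqP; rewrite -subr_eq0; apply/eqP; apply: nrm_le0 => e e0.
  have Kp : 0 <= 2 * K * nrm b * nrm c by rewrite !mulr_ge0 ?nrm_ge0.
  have [n Hn] := geometric_small t01 Kp e0; apply: le_trans (ltW Hn).
  rewrite (_ : _ - _ = (f b - w n b)^# ** c - b^# ** (g c - lstar (w n) c)).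
    apply: le_trans (nrmB _ _) _.
    apply: le_trans (lerD (nrmM _ _) (nrmM _ _)) _; rewrite !nrm_star.
    have h1 := Hf b n; have h2 := Hg c n.
    have := ler_wpM2r (nrm_ge0 c) h1; have := ler_wpM2l (nrm_ge0 b) h2; lra.
  rewrite cstarB cmulBl cmulBr lopP -[ladj _ _]/(lstar (w n) c).
  by rewrite opprB addrA subrK.
have fB : exists D, forall b, nrm (f b) <= D * nrm b.
  have [D D0 HD] := bnd_exists (w 0%N); exists (K + D) => b.
  rewrite -[f b](subrK (w 0%N b)) mulrDl; apply: le_trans (nrmD _ _) _.
  by rewrite lerD//; have := Hf b 0%N; rewrite expr0 mulr1.
by exists (Lop fP fB) => n b; rewrite lsubE -KE; exact: Hf.
Qed.

Lemma commZ S T (l : R[i]) : GRing.comm S T -> GRing.comm S (l *: T).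
Proof. by rewrite /GRing.comm lscaleAl lscaleAr => ->. Qed.

(** The equation says (1 - s)^2 = 1 - k, and its solution is a fixed point of [F]. The ball of
    radius [t] is stable since (t + t^2) / 2 <= t, and steps there shrink by the factor [t]. The
    iterates are polynomials in [k], whence the commutation clause. *)
Lemma sqrt1B k t : selfadjoint k -> 0 <= t < 1 -> bnd t k ->
  exists s, [/\ selfadjoint s, bnd t s, s + s - s * s = k &
    forall x, GRing.comm x k -> GRing.comm x s].
Proof.
move=> sk t01 kt; have /andP[t0 t1] := t01.
pose F s := 2^-1%:C *: (k + s * s); pose w n := iter n F 0.
have ws n : selfadjoint (w n).
  elim: n => [|n IH] /=; first by rewrite -lconst0; exact: selfadjoint_const.
  by apply: selfadjointZ; apply: selfadjointD => //; exact: selfadjointM.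
have wt n : bnd t (w n).
  elim: n => [|n IH] /=; first exact: bnd0.
  apply: bnd_le (bndZ _ (bndD kt (bndM t0 IH IH))) => //; nra.
have wc n x : GRing.comm x k -> GRing.comm x (w n).
  move=> xk; elim: n => [|n IH] /=; first exact: commr0.
  by apply: commZ; apply: commrD => //; exact: commrM.
have wd n : bnd (t * t ^+ n) (w n.+1 - w n).
  elim: n => [|n IH].
    rewrite expr0 mulr1 /= subr0 /F mulr0 addr0.
    by apply: bnd_le (bndZ _ kt) => //; nra.
  (* A difference of squares, split without commuting the factors; both iterates are bounded by [t],
     so the half sum gains a factor [t]. *)
  have -> : w n.+2 - w n.+1 =
      2^-1%:C *: (w n.+1 * (w n.+1 - w n) + (w n.+1 - w n) * w n).
    rewrite -[w n.+2]/(F (w n.+1)) -[X in _ - X]/(F (w n)) /F -scalerBr.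
    by rewrite mulrBr mulrBl addrA subrK opprD addrACA subrr add0r.
  have tn0 : 0 <= t * t ^+ n by rewrite mulr_ge0 ?exprn_ge0.
  apply: bnd_le (bndZ _ (bndD (bndM t0 (wt _) IH) (bndM tn0 IH (wt _)))) => //.
  rewrite exprS; lra.
have [s Hs] := lop_complete t0 t01 wd.
have [K K0 KE] : exists2 K, 0 <= K & K = t / (1 - t).
  by exists (t / (1 - t)) => //; rewrite divr_ge0// subr_ge0 ltW.
rewrite -KE in Hs.
exists s; have st : bnd t s.
  apply: bnd_lim => e e0; have [n Hn] := geometric_small t01 K0 e0.
  rewrite -[s](subrK (w n)) addrC; apply: bndD => //.
  by apply: bnd_le (Hs n); exact: ltW.
split=> //.
- apply/eqP; rewrite -subr_eq0; apply/eqP.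
  apply: (@bnd_geometric_eq0 (2 * K) t) => // [|n]; first by rewrite mulr_ge0.
  have -> : lstar s - s = lstar (s - w n) - (s - w n).
    by rewrite lstarB ws opprB addrA subrK.
  have Kn : 0 <= K * t ^+ n by rewrite mulr_ge0 ?exprn_ge0.
  apply: bnd_le (bndB (bnd_star Kn (Hs n)) (Hs n)); lra.
- apply/eqP; rewrite -subr_eq0; apply/eqP.
  apply: (@bnd_geometric_eq0 (4 * K) t) => // [|n]; first by rewrite mulr_ge0.
  have -> : s + s - s * s - k = (s - w n.+1) + (s - w n.+1)
      - (s * (s - w n) + (s - w n) * w n).
    have kE : k = w n.+1 + w n.+1 - w n * w n.
      rewrite /= /F -scalerDl -rmorphD/= (_ : 2^-1 + 2^-1 = 1 :> R); last lra.
      by rewrite scale1r addrK.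
    have -> : s * (s - w n) + (s - w n) * w n = s * s - w n * w n.
      by rewrite mulrBr mulrBl addrA subrK.
    rewrite {1}kE opprB addrACA.
    have -> : s - w n.+1 + (s - w n.+1) = s + s - (w n.+1 + w n.+1).
      by rewrite addrACA opprD.
    by rewrite opprB [RHS]addrACA (addrC (- (s * s))).
  have Kn : 0 <= K * t ^+ n by rewrite mulr_ge0 ?exprn_ge0.
  have b1 := Hs n.+1; have b2 := bndM t0 st (Hs n).
  have b3 := bndM Kn (Hs n) (wt n).
  apply: bnd_le (bndB (bndD b1 b1) (bndD b2 b3)); rewrite exprS; nra.
- move=> x xk; have [D D0 HD] := bnd_exists x.
  apply/eqP; rewrite -subr_eq0; apply/eqP.
  apply: (@bnd_geometric_eq0 (2 * D * K) t) => // [|n].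
    by rewrite !mulr_ge0// ltW.
  have -> : x * s - s * x = x * (s - w n) - (s - w n) * x.
    by rewrite mulrBr mulrBl (wc n x xk) opprB addrA subrK.
  have Kn : 0 <= K * t ^+ n by rewrite mulr_ge0 ?exprn_ge0.
  apply: bnd_le (bndB (bndM (ltW D0) HD (Hs n)) (bndM Kn (Hs n) HD)); lra.
Qed.

End OperatorBounds.

(** * Order estimates for self-adjoint operators, obtained from square roots *)

Section FunctionalCalculus.
Context {R : realType} {A : cstarAlgType R}.
Implicit Types (S T h k m s u v x y z : lop A) (b c : A) (r t e : R).

Lemma half_double T : 2^-1%:C *: (T + T) = T.
Proof.
rewrite scalerDr -scalerDl -rmorphD/= (_ : 2^-1 + 2^-1 = 1 :> R); last lra.
by rewrite scale1r.
Qed.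

Lemma bnd_sqr t T : 0 <= t -> bnd (t ^+ 2) (lstar T * T) -> bnd t T.
Proof.
move=> t0 HT b; rewrite -(@ler_pXn2r _ 2) ?nnegrE ?mulr_ge0 ?nrm_ge0//.
apply: le_trans (lop_sqr T b) _; have := HT b.
rewrite lmulE => /(ler_wpM2l (nrm_ge0 b)) /le_trans; apply.
by rewrite exprMn; lra.
Qed.

Lemma bnd_sqr_selfadjoint t h : selfadjoint h -> 0 <= t ->
  bnd (t ^+ 2) (h * h) -> bnd t h.
Proof. by move=> sh t0 H; apply: bnd_sqr => //; rewrite sh. Qed.

(* h + i v is sqrt t times a unitary. *)
Lemma bnd_sum_sqr h v t : selfadjoint h -> selfadjoint v -> GRing.comm h v ->
  0 <= t -> h * h + v * v = lconst t -> bnd (Num.sqrt t) h.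
Proof.
move=> sh sv hv t0 hvt.
have ii (w : lop A) : 'i%C *: ('i%C *: w) = - w.
  by rewrite scalerA -expr2 sqr_i scaleN1r.
pose y := h + 'i%C *: v.
have syE : lstar y = h - 'i%C *: v.
  by rewrite lstarD lstarZ sh sv conj_i scaleNr.
have yy : lstar y * y = lconst t.
  rewrite syE /y mulrDr !mulrBl !lscaleAl !lscaleAr ii hv -hvt opprK.
  by rewrite addrA subrK.
have by1 : bnd (Num.sqrt t) y.
  apply: bnd_sqr; first exact: sqrtr_ge0.
  by rewrite sqr_sqrtr// yy; exact: bnd_const.
have by2 := bnd_star (sqrtr_ge0 t) by1.
have -> : h = 2^-1%:C *: (y + lstar y).
  by rewrite syE /y addrACA subrr addr0 half_double.
apply: bnd_le (bndZ _ (bndD by1 by2)) => //; lra.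
Qed.

(** The hypothesis expresses that [h] is positive and invertible. With [s] given by [sqrt1B] for (t
    - h) / t, the root is sqrt t (1 - s). The clause on [r'] is the same hypothesis for [m], so that
    a further root can be extracted. *)
Lemma sqrt_shift h r t : selfadjoint h -> 0 <= r < t -> bnd r (lconst t - h) ->
  exists m, [/\ selfadjoint m, m * m = h,
    exists2 r', 0 <= r' < Num.sqrt t & bnd r' (lconst (Num.sqrt t) - m) &
    forall x, GRing.comm x h -> GRing.comm x m].
Proof.
move=> sh /andP[r0 rt] hr; have tp : 0 < t by exact: le_lt_trans rt.
have t0 := ltW tp; have sp : 0 < Num.sqrt t by rewrite sqrtr_gt0.
have [|||s [ss sr sk sc]] := @sqrt1B _ _ (t^-1%:C *: (lconst t - h)) (t^-1 * r).
- by apply: selfadjointZ; apply: selfadjointB => //; exact: selfadjoint_const.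
- by rewrite mulr_ge0 ?invr_ge0//= ltr_pdivrMl// mulr1.
- by apply: bndZ; rewrite ?invr_ge0.
have dE : lconst (Num.sqrt t) - (Num.sqrt t)%:C *: (1 - s) =
    (Num.sqrt t)%:C *: s.
  by rewrite scalerBr -lconst_mul mulr1 opprB addrC subrK.
exists ((Num.sqrt t)%:C *: (1 - s)); split.
- apply: selfadjointZ; apply: selfadjointB => //.
  by rewrite -lconst1; exact: selfadjoint_const.
- rewrite lscaleAl lscaleAr scalerA -rmorphM/= -expr2 sqr_sqrtr//.
  have -> : (1 - s) * (1 - s) = 1 - (s + s - s * s).
    by rewrite mulrBr mulr1 mulrBl mul1r -addrA -opprD addrA.
  rewrite sk scalerBr scalerA -rmorphM/= mulfV ?gt_eqF// scale1r.
  by rewrite -lconst_mul mulr1 opprB addrC subrK.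
- exists (Num.sqrt t * (t^-1 * r)); last first.
    by rewrite dE; apply: bndZ => //; exact: ltW.
  rewrite !mulr_ge0 ?invr_ge0 ?sqrtr_ge0//= gtr_pMr//.
  by rewrite ltr_pdivrMl// mulr1.
- move=> x xh; apply: commZ; apply: commrB; first exact: commr1.
  by apply: sc; apply: commZ; apply: commrB => //; exact: comm_lconst.
Qed.

Lemma commM_self h : GRing.comm h (h * h).
Proof. exact: commrM. Qed.

(** Let v be the square root of t + e - h^2. As h^2 + v^2 = t + e, [bnd_sum_sqr] bounds v by sqrt (t
    + e), hence v^2 by t + e. Subtracting e costs a second e, which is why e is half of the given
    tolerance. *)
Lemma bnd_const_sub_sqr h r t : selfadjoint h -> 0 <= r -> bnd r h ->
  r ^+ 2 <= t -> bnd t (lconst t - h * h).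
Proof.
move=> sh r0 hr rt; have t0 : 0 <= t by exact: le_trans (sqr_ge0 r) rt.
apply: bnd_lim => e' e'0; pose e := e' / 2.
have e0 : 0 < e by rewrite divr_gt0.
have te : 0 <= t + e by rewrite addr_ge0// ltW.
have shh : selfadjoint (h * h) by exact: selfadjointM.
have hh : bnd (r ^+ 2) (h * h) by rewrite expr2; exact: bndM.
have [|||v [sv vv _ vc]] := @sqrt_shift (lconst (t + e) - h * h) (r ^+ 2) (t + e).
- by apply: selfadjointB => //; exact: selfadjoint_const.
- by rewrite sqr_ge0/=; lra.
- by rewrite opprB addrC subrK.
have hv : GRing.comm h v.
  by apply: vc; apply: commrB; [exact: comm_lconst|exact: commM_self].
have bv : bnd (Num.sqrt (t + e)) v.
  apply: (@bnd_sum_sqr v h) => //.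
  by rewrite vv subrK.
have : bnd (t + e) (v * v).
  rewrite -[t + e]sqr_sqrtr// expr2; apply: bndM => //; exact: sqrtr_ge0.
rewrite vv => bvv; have := bndB bvv (bnd_const (ltW e0)).
have -> : lconst (t + e) - h * h - lconst e = lconst t - h * h.
  by rewrite lconstD addrAC addrK.
by rewrite -addrA /e -splitr.
Qed.

(** The hypothesis is h^2 <= t in disguise: it says exactly that t + e - h^2 lies within r + t of r
    + t + e, so it has a square root v, and h^2 + v^2 = t + e bounds h. *)
Lemma bnd_of_const_add_sqr h r t : selfadjoint h -> 0 <= r -> 0 <= t ->
  bnd (r + t) (lconst r + h * h) -> bnd (Num.sqrt t) h.
Proof.
move=> sh r0 t0 H b.
rewrite -(@ler_pXn2r _ 2) ?nnegrE ?mulr_ge0 ?nrm_ge0 ?sqrtr_ge0//.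
rewrite exprMn sqr_sqrtr//; apply/ler_addgt0Pl => e' e'0.
have nb : 0 < nrm b ^+ 2 + 1 by rewrite ltr_wpDl// sqr_ge0.
pose e := e' / (nrm b ^+ 2 + 1); have e0 : 0 < e by rewrite divr_gt0.
have te : 0 <= t + e by rewrite addr_ge0// ltW.
have shh : selfadjoint (h * h) by exact: selfadjointM.
have [|||v [sv vv _ vc]] :=
    @sqrt_shift (lconst (t + e) - h * h) (r + t) (r + t + e).
- by apply: selfadjointB => //; exact: selfadjoint_const.
- by rewrite addr_ge0//=; lra.
- suff -> : lconst (r + t + e) - (lconst (t + e) - h * h) = lconst r + h * h by [].
  have -> : r + t + e = r + (t + e) by rewrite addrA.
  by rewrite lconstD opprB addrA addrAC addrK.
have hv : GRing.comm h v.
  by apply: vc; apply: commrB; [exact: comm_lconst|exact: commM_self].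
have /(_ b) : bnd (Num.sqrt (t + e)) h.
  by apply: (@bnd_sum_sqr h v) => //; rewrite vv addrC subrK.
rewrite -(@ler_pXn2r _ 2) ?nnegrE ?mulr_ge0 ?nrm_ge0 ?sqrtr_ge0//.
rewrite exprMn sqr_sqrtr// mulrDl => /le_trans; apply; rewrite addrC lerD2r.
rewrite /e mulrAC ler_pdivrMr// ler_wpM2l ?lerDl//; exact: ltW.
Qed.

End FunctionalCalculus.

(** * Positivity of x^* x *)

Section Kaplansky.
Context {R : realType} {A : cstarAlgType R}.
Implicit Types (S T h k m s u v x y z : lop A) (b c : A) (r t e : R).

Lemma sqr_add_sub (V : pzRingType) (p q : V) :
  (p + q) * (p + q) - (p - q) * (p - q) = (p * q + q * p) + (p * q + q * p).
Proof.
have E (w : V) : (p + w) * (p + w) = p * p + w * w + (p * w + w * p).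
  rewrite mulrDr !mulrDl [X in _ + X]addrC addrACA; congr (_ + _).
  by rewrite addrC.
rewrite !E mulrNN mulrN mulNr -opprD opprB (addrC (p * p + _)).
by rewrite addrACA subrr addr0.
Qed.

(* sigma(y y^* ) and sigma(y^* y) agree away from 0, since
   y f(y^* y) y^* = y y^* f(y y^* ). *)
Lemma bnd_star_swap y r e : 0 <= r -> 0 < e ->
  bnd (r + e) (lconst r + lstar y * y) -> bnd (r + e) (lconst r + y * lstar y).
Proof.
move=> r0 e0 H; set t := r + e; have t0 : 0 <= t by rewrite addr_ge0// ltW.
set G := lconst r + y * lstar y; have [Y Y0 HY] := bnd_exists y.
pose G' := lconst r + lstar y * y.
have yG n : G ^+ n * y = y * G' ^+ n.
  elim: n => [|n IH]; first by rewrite !expr0 mul1r mulr1.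
  rewrite exprSr exprS -mulrA (_ : G * y = y * G').
    by rewrite mulrA IH -mulrA -exprSr exprS.
  by rewrite mulrDl mulrDr -mulrA (comm_lconst y r).
have Gd n : bnd (Y * t ^+ n * Y) (G ^+ n * (y * lstar y)).
  rewrite mulrA yG; apply: bndM.
  - by rewrite mulr_ge0 ?exprn_ge0// ltW.
  - by apply: bndM => //; [exact: ltW|exact: bndX].
  - by apply: bnd_star => //; exact: ltW.
(* Chosen so that [K * r + Y * Y <= K * (r + e)], the inequality that closes the induction on the
   powers of [G]. *)
pose K := 1 + Y * Y / e.
have K1 : 1 <= K by rewrite lerDl divr_ge0 ?mulr_ge0// ltW.
have eK : Y * Y <= e * K.
  by rewrite mulrDr mulr1 mulrCA mulfV ?gt_eqF// mulr1 lerDr ltW.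
have GK n : bnd (K * t ^+ n) (G ^+ n).
  elim: n => [|n IH].
    by rewrite !expr0 mulr1; apply: bnd_le K1 _ => b; rewrite mul1r.
  have -> : G ^+ n.+1 = G ^+ n * lconst r + G ^+ n * (y * lstar y).
    by rewrite exprSr -mulrDr.
  have tn : 0 <= t ^+ n by rewrite exprn_ge0.
  have Kt : 0 <= K * t ^+ n by rewrite mulr_ge0// (le_trans _ K1).
  apply: bnd_le (bndD (bndM Kt IH (bnd_const r0)) (Gd n)).
  have -> : t ^+ n.+1 = (r + e) * t ^+ n by rewrite exprS.
  have := ler_wpM2r tn eK; lra.
have sG : selfadjoint G.
  by apply: selfadjointD; [exact: selfadjoint_const|exact: selfadjoint_mul_star].
(* [G] is self-adjoint, so the norms of [(G ^+ n) b] are log-convex and the constant [K]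
   disappears. *)
move=> b; apply: (@log_convex_le R (fun n => nrm ((G ^+ n) b)) (K * nrm b)) => // n.
- exact: nrm_ge0.
- by have := selfadjoint_sqr ((G ^+ n) b) sG; rewrite -!lmulE -!exprS.
- by rewrite mulrAC; exact: GK.
Qed.

(** Averaging the squares of r + h and r - h gives r^2 + h^2 <= (r + e)^2, that is, h^2 <= 2 r e +
    e^2. This is weaker than the optimal bound e, but tends to 0 with e. *)
Lemma bnd_two_sided h r e : selfadjoint h -> 0 <= r -> 0 <= e ->
  bnd (r + e) (lconst r + h) -> bnd (r + e) (lconst r - h) ->
  bnd (Num.sqrt (2 * r * e + e ^+ 2)) h.
Proof.
move=> sh r0 e0 H1 H2; have re : 0 <= r + e by rewrite addr_ge0.
apply: (@bnd_of_const_add_sqr _ _ h (r ^+ 2)) => //.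
- exact: sqr_ge0.
- by rewrite addr_ge0 ?sqr_ge0// !mulr_ge0.
have := bndZ (_ : 0 <= 2^-1) (bndD (bndM re H1 H1) (bndM re H2 H2)).
rewrite invr_ge0 => /(_ (ler0n _ _)).
have -> : (lconst r + h) * (lconst r + h) + (lconst r - h) * (lconst r - h) =
    (lconst (r ^+ 2) + h * h) + (lconst (r ^+ 2) + h * h).
  have E (w : lop A) : GRing.comm w (lconst r) -> (lconst r + w) * (lconst r + w)
      = lconst (r ^+ 2) + w * w + (lconst r * w + lconst r * w).
    move=> wr; rewrite mulrDr !mulrDl -lconstM -expr2 wr -!addrA; congr (_ + _).
    by rewrite [RHS]addrC addrA.
  rewrite !E; [|exact: comm_lconst..].
  by rewrite mulrNN !mulrN -opprD addrACA subrr addr0.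
by rewrite half_double; apply: bnd_le; lra.
Qed.

(** A nearly negative y^* y is small. Then y y^* <= e too, by [bnd_star_swap]; and y y^* + y^* y is
    half the sum of the squares of the self-adjoint [a] and [w], so y y^* >= - y^* y >= - e. Thus y
    y^* is small, and so is y by the C*-identity. *)
Lemma bnd_star_mul_of_le y r e Y : 0 <= r -> 0 < e -> 0 <= Y -> bnd Y y ->
  bnd (r + e) (lconst r + lstar y * y) ->
  bnd (Num.sqrt (2 * (4 * Y ^+ 2 + r) * e + e ^+ 2)) (lstar y * y).
Proof.
move=> r0 e0 Y0 HY H; have Hs := bnd_star_swap r0 e0 H.
have HYs := bnd_star Y0 HY.
(* [a] and [w] have norm at most 2 Y, so 4 Y^2 - a^2 and 4 Y^2 - w^2 are positive; half their sum
   plus r + y^* y is exactly [r1] - y y^*. *)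
pose r1 := 4 * Y ^+ 2 + r; pose d := y * lstar y.
have q0 : 0 <= 4 * Y ^+ 2 by rewrite mulr_ge0 ?sqr_ge0.
have r10 : 0 <= r1 by rewrite addr_ge0.
pose a := y + lstar y; pose w := 'i%C *: (y - lstar y).
have sa_ : selfadjoint a by rewrite /selfadjoint lstarD lstarK addrC.
have sw : selfadjoint w.
  by rewrite /selfadjoint lstarZ lstarB lstarK conj_i scaleNr -scalerN opprB.
have Y2 : 0 <= 2 * Y by rewrite mulr_ge0.
have Ya : bnd (2 * Y) a by apply: bnd_le (bndD HY HYs); lra.
have Yw : bnd (2 * Y) w.
  move=> b; rewrite lscaleE nrmZ normc_def/= expr0n/= add0r expr1n sqrtr1 mul1r.
  by apply: (bnd_le _ (bndB HY HYs)); lra.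
have a2 := bnd_const_sub_sqr sa_ Y2 Ya (_ : _ <= 4 * Y ^+ 2).
have w2 := bnd_const_sub_sqr sw Y2 Yw (_ : _ <= 4 * Y ^+ 2).
have Ysq : (2 * Y) ^+ 2 <= 4 * Y ^+ 2 by rewrite exprMn; lra.
have aw : a * a + w * w = (d + lstar y * y) + (d + lstar y * y).
  have -> : w * w = - ((y - lstar y) * (y - lstar y)).
    by rewrite /w lscaleAl lscaleAr scalerA -expr2 sqr_i scaleN1r.
  by rewrite /a sqr_add_sub.
have dK : bnd (r1 + e) (lconst r1 - d).
  have := bndD (bndZ (_ : 0 <= 2^-1) (bndD (a2 Ysq) (w2 Ysq))) H.
  rewrite invr_ge0 => /(_ (ler0n _ _)).
  have -> : 2^-1%:C *: (lconst (4 * Y ^+ 2) - a * a + (lconst (4 * Y ^+ 2) - w * w))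
      + (lconst r + lstar y * y) = lconst r1 - d.
    rewrite addrACA -opprD aw opprD addrACA half_double opprD.
    by rewrite addrACA subrK -lconstD.
  by apply: bnd_le; rewrite /r1; lra.
have dK' : bnd (r1 + e) (lconst r1 + d).
  have -> : lconst r1 + d = lconst (4 * Y ^+ 2) + (lconst r + d).
    by rewrite lconstD addrA.
  by apply: bnd_le (bndD (bnd_const q0) Hs); rewrite /r1; lra.
have := bnd_two_sided (selfadjoint_mul_star y) r10 (ltW e0) dK' dK.
set kap := Num.sqrt _ => Hd.
have kap0 : 0 <= kap by exact: sqrtr_ge0.
have ys : bnd (Num.sqrt kap) (lstar y).
  by apply: bnd_sqr; [exact: sqrtr_ge0|rewrite sqr_sqrtr// lstarK].
have yy : bnd (Num.sqrt kap) y.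
  by rewrite -[y]lstarK; apply: bnd_star => //; exact: sqrtr_ge0.
have := bndM (sqrtr_ge0 _) ys yy; by rewrite -expr2 sqr_sqrtr.
Qed.

(** For a = x^* x take m = sqrt (a^2 + th^2), close to |a|, and show that c = m - a, close to twice
    the negative part of a, is small. With e = th^2 one has c^2 = 2 m c - e, so y = x c satisfies
    y^* y = e c - m c^2, which is nearly negative and hence small. Then m c^2, c^3 and c^4 are small
    in turn. It matters that [r] and [K] do not depend on the tolerance. *)
Lemma sqrt_approx x : exists r K, [/\ 0 <= r, 0 < K &
  forall e, 0 < e <= 1 -> exists2 m, bnd r (lconst r - m) &
    bnd (Num.sqrt (Num.sqrt (e * K))) (m - lstar x * x)].
Proof.
have [B B0 HB] := bnd_exists x; set a := lstar x * x.
have sa_ : selfadjoint a := selfadjoint_star_mul x.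
have [al al0 Ha] := bnd_exists a.
pose M := al ^+ 2 + 1; pose r := Num.sqrt M.
have M0 : 0 < M by rewrite ltr_wpDl// sqr_ge0.
have r0 : 0 <= r by exact: sqrtr_ge0.
pose g := 2 * r + al.
have g0 : 0 < g by rewrite ltr_wpDl// mulr_ge0.
pose R0 := 2 * r * g ^+ 2; have R00 : 0 <= R0.
  by rewrite mulr_ge0 ?sqr_ge0// mulr_ge0.
pose Y := B * g; have Y0 : 0 <= Y by rewrite mulr_ge0// ltW.
pose R1 := 4 * Y ^+ 2 + R0.
have R10 : 0 <= R1 by rewrite addr_ge0// mulr_ge0// sqr_ge0.
pose K1 := Num.sqrt (2 * R1 * g + g ^+ 2).
have K10 : 0 <= K1 by exact: sqrtr_ge0.
exists r, (g * (3 * g + 2 * K1)); split=> // [|th /andP[th0 th1]].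
  by apply: mulr_gt0 => //; lra.
(* The bound on y^* y is of the order of sqrt e; with e = [th ^+ 2] it is linear in [th]. *)
pose e := th ^+ 2; have e0 : 0 < e by rewrite exprn_gt0.
have eth : e <= th by rewrite /e expr2; nra.
have e1 : e <= 1 by exact: le_trans th1.
have al2 : al ^+ 2 <= M - e by rewrite /M; lra.
have sh : selfadjoint (a * a + lconst e).
  by apply: selfadjointD; [exact: selfadjointM|exact: selfadjoint_const].
have [||m [sm mm [r' r'r Hm] mc]] := @sqrt_shift _ _ (a * a + lconst e) (M - e) M sh.
- by rewrite (le_trans (sqr_ge0 al) al2)/=; lra.
- rewrite opprD addrA addrAC -lconstN -lconstD.
  exact: bnd_const_sub_sqr (ltW al0) Ha al2.
have [Z [sZ ZZ _ Zc]] := sqrt_shift sm r'r Hm.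
have am : GRing.comm a m.
  by apply: mc; apply: commrD; [exact: commM_self|exact: comm_lconst].
have Hrm : bnd r (lconst r - m) by apply: bnd_le Hm; case/andP: r'r => _ /ltW.
exists m => //; set c := m - a.
have sc : selfadjoint c by exact: selfadjointB.
have ac : GRing.comm a c by apply: commrB.
have mc' : GRing.comm m c by apply: commrB => //; exact: esym.
have Zm : GRing.comm Z m by rewrite -ZZ; exact: commM_self.
have Zc' : GRing.comm Z c.
  by apply: commrB => //; apply: commr_sym; exact: Zc.
have Hmb : bnd (2 * r) m.
  rewrite -[m](subKr (lconst r)).
  by apply: bnd_le (bndB (bnd_const r0) Hrm); lra.
have Hc : bnd g c by exact: bndB.
have cc : c * c = m * c + m * c - lconst e.
  have acE : a * c = lconst e - m * c.
    by rewrite /c !mulrBr mm am opprB opprD [RHS]addrC -!addrA addNr addr0.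
  by rewrite {1}/c mulrBl acE opprB addrA.
pose z := Z * c; have sz : selfadjoint z by exact: selfadjointM.
have zz : z * z = m * (c * c).
  by rewrite /z mulrA -(mulrA Z c Z) -Zc' mulrA ZZ -mulrA.
have Hzz : bnd R0 (z * z).
  rewrite zz /R0 expr2; apply: bndM => //; first by rewrite mulr_ge0.
  by apply: bndM => //; exact: ltW.
have Hz : bnd (Num.sqrt R0) z.
  by apply: bnd_sqr_selfadjoint; rewrite ?sqrtr_ge0 ?sqr_sqrtr.
pose y := x * c; have Hy : bnd Y y by apply: bndM => //; exact: ltW.
have ccc : c * (c * c) = z * z + z * z - e%:C *: c.
  rewrite zz -(lconst_mul e) -(comm_lconst c e) {1}cc mulrBr mulrDr.
  by rewrite (mulrA c m) -mc' -mulrA.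
have yy : lstar y * y = e%:C *: c - z * z.
  have -> : lstar y * y = a * (c * c).
    by rewrite /y lstarM sc -mulrA (mulrA _ x) -/a mulrA -ac mulrA.
  rewrite (_ : a = m - c); last by rewrite /c subKr.
  by rewrite mulrBl -zz ccc opprB addrCA opprD addNKr.
have eg0 : 0 < e * g by rewrite mulr_gt0.
have Hyy : bnd (R0 + e * g) (lconst R0 + lstar y * y).
  rewrite yy addrCA addrC; apply: bndD; last by apply: bndZ => //; exact: ltW.
  by apply: bnd_const_sub_sqr Hz _; rewrite ?sqrtr_ge0// sqr_sqrtr.
have := bnd_star_mul_of_le R00 eg0 Y0 Hy Hyy.
rewrite -/R1; set kap := Num.sqrt (2 * R1 * (e * g) + _) => Hk.
have kap1 : kap <= th * K1.
  have -> : th * K1 = Num.sqrt (e * (2 * R1 * g + g ^+ 2)).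
    by rewrite sqrtrM ?ltW// /e sqrtr_sqr ger0_norm// ltW.
  rewrite ler_wsqrtr//; have e2 : e ^+ 2 <= e by nra.
  have aux (p q f : R) : q ^+ 2 <= q ->
      2 * p * (q * f) + (q * f) ^+ 2 <= q * (2 * p * f + f ^+ 2).
    by move=> /(ler_wpM2r (sqr_ge0 f)); lra.
  exact: aux e2.
have Hz2 : bnd (e * g + kap) (z * z).
  have -> : z * z = e%:C *: c - lstar y * y by rewrite yy opprB addrC subrK.
  by apply: bndB => //; apply: bndZ => //; exact: ltW.
have H3 : bnd (3 * e * g + 2 * kap) (c * (c * c)).
  rewrite ccc; apply: bnd_le (bndB (bndD Hz2 Hz2) (bndZ (ltW e0) Hc)); lra.
(* c^3 = 2 m c^2 - e c has norm at most 2 (e g + kap) + e g, with kap <= th K1 and e <= th; one more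
   factor c costs g. *)
have H4 : bnd (th * (g * (3 * g + 2 * K1))) ((c * c) * (c * c)).
  rewrite -mulrA; apply: bnd_le (bndM (ltW g0) Hc H3).
  have aux (p q f k l : R) : 0 < f -> p <= q -> k <= q * l ->
      f * (3 * p * f + 2 * k) <= q * (f * (3 * f + 2 * l)).
    move=> f0 pq kl; rewrite (mulrCA q) ler_pM2l//.
    have := ler_wpM2r (ltW f0) pq; lra.
  exact: aux g0 eth kap1.
apply: bnd_sqr_selfadjoint => //.
rewrite sqr_sqrtr ?sqrtr_ge0//; apply: bnd_sqr_selfadjoint.
- exact: selfadjointM.
- exact: sqrtr_ge0.
rewrite sqr_sqrtr//.
by rewrite !mulr_ge0 ?addr_ge0// ?mulr_ge0// ltW.
Qed.

Lemma kaplansky x : exists2 r, 0 <= r & bnd r (lconst r - lstar x * x).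
Proof.
have [r [K [r0 K0 H]]] := sqrt_approx x; exists r => //; apply: bnd_lim => t t0.
(* The fourth root of [e * K] is then at most [t]; the cap 1 is required by [sqrt_approx]. *)
pose e := Num.min 1 (t ^+ 4 / K).
have e0 : 0 < e by rewrite lt_min ltr01 divr_gt0// exprn_gt0.
have [|m Hm Hma] := H e; first by rewrite e0 ge_min lexx.
have -> : lconst r - lstar x * x = (lconst r - m) + (m - lstar x * x).
  by rewrite addrA subrK.
apply: bndD => //; apply: bnd_le Hma.
have eK : e * K <= t ^+ 4 by rewrite -ler_pdivlMr// ge_min lexx orbT.
have -> : t = Num.sqrt (Num.sqrt (t ^+ 4)).
  rewrite (_ : t ^+ 4 = (t ^+ 2) ^+ 2); last by rewrite -exprM.
  by rewrite sqrtr_sqr (ger0_norm (sqr_ge0 _)) sqrtr_sqr ger0_norm// ltW.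
by rewrite !ler_wsqrtr.
Qed.

End Kaplansky.

(** * Existence of states *)

Section States.
Context {R : realType} {A : cstarAlgType R}.
Implicit Types (a b c w x y : A) (r s t e : R).

(* c <= t in the unitization of A, for self-adjoint c *)
Definition dominated t c :=
  exists2 r, 0 <= r & forall y, nrm (r%:C *: y + c ** y) <= (r + t) * nrm y.

Lemma dominatedD s t a b :
  dominated s a -> dominated t b -> dominated (s + t) (a + b).
Proof.
move=> [p p0 Hp] [q q0 Hq]; exists (p + q) => [|y]; first by rewrite addr_ge0.
rewrite rmorphD/= scalerDl cmulDl addrACA; apply: le_trans (nrmD _ _) _.
by have := lerD (Hp y) (Hq y); lra.
Qed.

Lemma dominatedZ r t a : 0 <= r -> dominated t a ->
  dominated (r * t) (r%:C *: a).
Proof.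
move=> r0 [p p0 Hp]; exists (r * p) => [|y]; first by rewrite mulr_ge0.
rewrite cmulZl rmorphM/= -scalerA -scalerDr nrmZp// -mulrDr -mulrA.
by rewrite ler_wpM2l.
Qed.

Lemma dominated_nrm c : dominated (nrm c) c.
Proof. by exists 0 => // y; rewrite scale0r !add0r nrmM. Qed.

Lemma dominatedN_star x : dominated 0 (- (x^# ** x)).
Proof.
have [r r0 H] := kaplansky (lmult x); exists r => // y.
by rewrite addr0 cmulNl; have := H y; rewrite lsubE /= cmulA.
Qed.

Lemma cstar_pos x : (x^# ** x)^# = x^# ** x.
Proof. by rewrite cstarM cstarK. Qed.

(** Using a + a^* rather than a makes this real sublinear on all of [A], at the price of a factor 2
    on self-adjoint elements. Adding [b] turns a functional below the gauge into one vanishing on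
    [B], and t >= 0 keeps the infimum bounded below. *)
Definition gauge (B : set A) a : R :=
  inf [set t | 0 <= t /\ exists2 b, B b & dominated t (a + a^# + b)].

Section Gauge.
Variable B : set A.
Hypothesis B0 : B 0.
Hypothesis BD : forall a b, B a -> B b -> B (a + b).
Hypothesis BZ : forall r b, B b -> B (r%:C *: b).

Let S a : set R := [set t | 0 <= t /\ exists2 b, B b & dominated t (a + a^# + b)].

Let S_lb a : has_lbound (S a).
Proof. by exists 0 => t []. Qed.

Lemma gauge_le t a b : 0 <= t -> B b -> dominated t (a + a^# + b) ->
  gauge B a <= t.
Proof. by move=> t0 Bb H; apply: (ge_inf (S_lb a)); split=> //; exists b. Qed.

Lemma gauge_lt t a : gauge B a < t ->
  exists2 b, B b & dominated t (a + a^# + b).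
Proof.
rewrite -subr_gt0 => at0; have hS : has_inf (S a).
  split=> //; exists (nrm (a + a^#)); split; first exact: nrm_ge0.
  by exists 0 => //; rewrite addr0; exact: dominated_nrm.
have [s [s0 [b Bb H]] st] := inf_adherent at0 hS.
have {}st : s < t by move: st; rewrite addrC subrK.
exists b => //; have [r r0 Hr] := H; exists r => // y.
by apply: le_trans (Hr y) _; rewrite ler_wpM2r ?nrm_ge0// lerD2l ltW.
Qed.

Lemma gauge_sublinear : sublinear (gauge B).
Proof.
apply: sublinear_inf => // [a|a b s t|r a s].
- exists (nrm (a + a^#)); split; first exact: nrm_ge0.
  by exists 0 => //; rewrite addr0; exact: dominated_nrm.
- move=> [s0 [c Bc Hs]] [t0 [d Bd Ht]]; exists (s + t) => //.
  split; first by rewrite addr_ge0.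
  exists (c + d); first exact: BD.
  by rewrite cstarD (addrACA a b) (addrACA (a + _)); exact: dominatedD.
- move=> r0 [s0 [c Bc Hs]]; exists (r * s) => //.
  split; first by rewrite mulr_ge0// ltW.
  exists (r%:C *: c); first exact: BZ.
  by rewrite cstarZr -!scalerDr; apply: dominatedZ => //; exact: ltW.
Qed.

End Gauge.

(** The usual complex-linear functional with real part [f], namely f (a) - i f (i a). *)
Definition complexify (f : A -> R) a : R[i] := f a +i* (- f ('i%C *: a)).

Lemma complexify_scalar (f : A -> R) :
  (forall a b, f (a + b) = f a + f b) ->
  (forall r a, f (r%:C *: a) = r * f a) -> scalar (complexify f).
Proof.
move=> fD fZ; have fk (x y : R) a :
    f ((x +i* y) *: a) = x * f a + y * f ('i%C *: a).
  rewrite -!fZ -fD scalerA -scalerDl; congr (f (_ *: a)).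
  by apply/eqP; rewrite eq_complex /=; apply/andP; split; apply/eqP; ring.
move=> [x y] a b; apply/eqP; rewrite eq_complex /= fD scalerDr fD (fk x y).
have -> : 'i%C *: ((x +i* y) *: a) = ((- y) +i* x) *: a.
  rewrite scalerA; congr (_ *: a); apply/eqP.
  by rewrite eq_complex /=; apply/andP; split; apply/eqP; ring.
rewrite (fk (- y) x); apply/andP; split; apply/eqP; ring.
Qed.

Lemma normc_le_sum (p q : R) : complex.Re `|p +i* q| <= `|p| + `|q|.
Proof.
rewrite normc_def /= -(@ler_pXn2r _ 2) ?nnegrE ?sqrtr_ge0 ?addr_ge0//.
rewrite sqr_sqrtr ?addr_ge0 ?sqr_ge0//.
rewrite -(real_normK (num_real p)) -(real_normK (num_real q)).
have := mulr_ge0 (normr_ge0 p) (normr_ge0 q); lra.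
Qed.

(** Without a unit, the norm of a positive functional cannot be read off at 1: it is the supremum
    [N] over the unit ball, positive because [phi w] is nonzero. *)
Lemma scale_state (phi : A -> R[i]) C w : scalar phi ->
  (forall a, cpos a -> 0 <= phi a) ->
  (forall a, complex.Re `|phi a| <= C * nrm a) -> phi w != 0 ->
  exists2 r, 0 < r & is_state (fun a => r%:C * phi a).
Proof.
move=> phis phip phiC pw.
pose E := [set complex.Re `|phi a| | a in [set a | nrm a <= 1]].
have phi0 := scalar_eq0 phis; have phiZ k a := scalar_mul k a phis.
have wn : 0 < nrm w.
  rewrite lt0r nrm_ge0 andbT; apply: contra_neq pw => /nrm0_eq0 ->.
  by rewrite phi0.
have rn (z : R[i]) : `|z| = (complex.Re `|z|)%:C.
  by rewrite RRe_real// normr_real.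
have C0 : 0 <= C.
  by rewrite -(pmulr_lge0 _ wn) (le_trans _ (phiC w))// Re_normr_ge0.
have hE : has_sup E.
  split; first by exists (complex.Re `|phi 0|); exists 0 => //=; rewrite nrm0.
  exists C => _ [a /= a1 <-]; apply: le_trans (phiC a) _.
  by rewrite -[leRHS]mulr1 ler_wpM2l.
pose N := sup E.
have EN a : nrm a <= 1 -> complex.Re `|phi a| <= N.
  by move=> a1; apply: sup_upper_bound => //; exists a.
have N0 : 0 < N.
  apply: lt_le_trans (EN ((nrm w)^-1%:C *: w) _); last first.
    by rewrite nrmZp ?invr_ge0 ?nrm_ge0// mulVf ?gt_eqF.
  rewrite lt0r Re_normr_ge0 andbT phiZ; apply: contra_neq pw => z0.
  have /eqP := rn ((nrm w)^-1%:C * phi w); rewrite z0 normr_eq0 mulf_eq0.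
  by rewrite fmorph_eq0 invr_eq0 gt_eqF//= => /eqP.
exists N^-1; rewrite ?invr_gt0//; split.
- by move=> k a b; rewrite phis mulrDr mulrCA.
- by move=> a a0; rewrite mulr_ge0 ?phip// ler0c invr_ge0 ltW.
have nV a : `|N^-1%:C * phi a| = (N^-1 * complex.Re `|phi a|)%:C.
  rewrite normrM (rn (phi a)) rmorphM/=; congr (_ * _).
  by rewrite ger0_norm// ler0c invr_ge0 ltW.
have nle a : (`|a| <= 1) = (nrm a <= 1) by rewrite nrmE lecR.
split.
  move=> _ [a /= a1 <-]; rewrite nV lecR ler_pdivrMl// mulr1 EN//.
  by rewrite -nle.
move=> u Hu; have u0 : 0 <= u.
  apply: (Hu); exists 0; first by rewrite /= normr0 ler01.
  by rewrite phi0 mulr0 normr0.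
have uE : u = (complex.Re u)%:C by rewrite RRe_real// ger0_real.
rewrite uE lecR -(ler_pM2l N0) mulr1; apply: sup_le_ub; first by case: hE.
move=> _ [a /= a1 <-]; rewrite -ler_pdivrMl// -lecR -uE -nV.
by apply: Hu; exists a => //=; rewrite nle.
Qed.

(* Hahn-Banach for the gauge: a functional below it is positive by Kaplansky's
   theorem and vanishes on B. *)
Lemma dominated_of_states (B : set A) w : B 0 ->
  (forall a b, B a -> B b -> B (a + b)) ->
  (forall r b, B b -> B (r%:C *: b)) ->
  (forall b, B b -> b^# = b) -> w^# = w ->
  (forall phi : A -> R[i], is_state phi -> (forall b, B b -> phi b = 0) ->
    complex.Re (phi w) <= 0) ->
  forall e, 0 < e -> exists2 b, B b & dominated e (w + b).
Proof.
move=> B0 BD BZ Bsa wsa Hw; have gs := gauge_sublinear B0 BD BZ.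
have [w0|w0] := lerP (gauge B w) 0.
  (* The gauge of [w] concerns w + w^* = 2 w, whence [2 * e] and the halving of [b]. *)
  move=> e e0; have [|b Bb H] := gauge_lt B0 (_ : gauge B w < 2 * e).
    by apply: le_lt_trans w0 _; rewrite mulr_gt0.
  exists (2^-1%:C *: b); first exact: BZ.
  have := dominatedZ (_ : 0 <= 2^-1) H; rewrite invr_ge0 => /(_ (ler0n _ _)).
  rewrite mulKf ?pnatr_eq0// wsa scalerDr (scalerDr _ w) -scalerDl -rmorphD/=.
  by rewrite (_ : 2^-1 + 2^-1 = 1 :> R) ?scale1r//; lra.
have [f [fD fZ fg fw]] := hahn_banach w gs.
have fN a : f (- a) = - f a.
  by have := fZ (-1) a; rewrite rmorphN1 scaleN1r mulN1r.
have f0 a : dominated 0 (a + a^#) -> f a <= 0.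
  move=> H; apply: le_trans (fg a) _; apply: gauge_le B0 _ => //.
  by rewrite addr0.
(* The symmetrization of i a vanishes, and so does that of - i a; hence [complexify f] is real on
   self-adjoint elements. *)
have fi a : a^# = a -> f ('i%C *: a) = 0.
  move=> sa_; have H : 'i%C *: a + ('i%C *: a)^# = 0.
    rewrite cstarZ sa_ -scalerDl (_ : 'i%C + 'i%C^*%C = 0) ?scale0r//.
    by apply/eqP; rewrite eq_complex /= addr0 subrr !eqxx.
  have d0 : dominated 0 (0 : A).
    by exists 0 => // y; rewrite scale0r add0r cmul0l nrm0 addr0 mul0r.
  apply/eqP; rewrite eq_le f0 ?H//=.
  rewrite -oppr_le0 -fN; apply: f0.
  by rewrite cstarN -opprD H oppr0.
have fB b : B b -> f b = 0.
  move=> Bb; have H b' : B b' -> f b' <= 0.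
    move=> Bb'; apply: le_trans (fg b') _.
    (* This element of [B] cancels b' + b'^* = 2 b'. *)
    apply: (@gauge_le _ _ _ ((-2)%:C *: b')); [by []|exact: BZ|].
    rewrite (Bsa _ Bb') rmorphN/= scaleNr -[2]/(1 + 1) rmorphD/= scalerDl.
    rewrite scale1r subrr.
    by exists 0 => // y; rewrite scale0r add0r cmul0l nrm0 addr0 mul0r.
  apply/eqP; rewrite eq_le H//= -oppr_le0 -fN; apply: H.
  by have := BZ (-1) b Bb; rewrite rmorphN1 scaleN1r.
have fle a : f a <= 2 * nrm a.
  apply: le_trans (fg a) _; apply: le_trans (_ : nrm (a + a^#) <= _).
    apply: gauge_le B0 _; [exact: nrm_ge0|].
    by rewrite addr0; exact: dominated_nrm.
  by apply: le_trans (nrmD _ _) _; rewrite nrm_star; lra.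
have fabs a : `|f a| <= 2 * nrm a.
  rewrite ler_norml fle andbT -subr_ge0 opprK addrC.
  by have := fle (- a); rewrite fN nrmN; lra.
have phis := complexify_scalar fD fZ; pose phi := complexify f.
have phip a : cpos a -> 0 <= phi a.
  move=> [x ->]; rewrite /phi /complexify fi ?cstar_pos// oppr0 ler0c.
  rewrite -oppr_le0 -fN; apply: f0; rewrite cstarN cstar_pos.
  by rewrite -[0]addr0; apply: dominatedD; exact: dominatedN_star.
have phiC a : complex.Re `|phi a| <= 4 * nrm a.
  apply: le_trans (normc_le_sum _ _) _; rewrite normrN.
  have := fabs a; have := fabs ('i%C *: a).
  rewrite nrmZ normc_def/= expr0n/= add0r expr1n sqrtr1 mul1r; lra.
have pw : phi w != 0.
  rewrite /phi /complexify eq_complex /= negb_and; apply/orP; left.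
  by rewrite fw gt_eqF.
have [r r0 rst] := scale_state phis phip phiC pw.
have : complex.Re (r%:C * phi w) <= 0.
  apply: Hw rst _ => b Bb; rewrite /phi /complexify fB// fi ?Bsa// oppr0.
  exact: mulr0.
rewrite /= mul0r subr0 fw => /(lt_le_trans (mulr_gt0 r0 w0)).
by rewrite ltxx.
Qed.

End States.

(** * Hilbert spaces *)

Section Operators.
Context {R : realType} {H : normedModType R[i]}.

Lemma bounded_operator_bound (T : H -> H) : linear T -> continuous T ->
  exists2 D : R, 0 < D & forall x, nrm (T x) <= D * nrm x.
Proof.
move=> Tl /(_ 0) /= Tc; have T0 := linear_eq0 Tl.
have TZ k x := linear_scale k x Tl.
have : nbhs (T 0) [set y | nrm y < 1].
  by rewrite T0; apply/nbhs_nrm; exists 1 => // y; rewrite sub0r nrmN.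
move=> /Tc /nbhs_nrm[d d0 Hd]; exists (2 / d); first by rewrite divr_gt0.
move=> x; have [-> |x0] := eqVneq x 0; first by rewrite T0 nrm0 mulr0.
have nx : 0 < nrm x.
  by rewrite lt0r nrm_ge0 andbT; apply: contra_neq x0 => /nrm0_eq0.
have s0 : 0 < d / 2 / nrm x by rewrite !divr_gt0.
have /Hd : nrm (0 - (d / 2 / nrm x)%:C *: x) < d.
  rewrite sub0r nrmN nrmZp ?ltW// divfK ?gt_eqF//; lra.
rewrite /= TZ nrmZp ?(ltW s0)// => kT; apply: ltW.
move: kT; rewrite mulrC -ltr_pdivlMr// mul1r => kT; apply: lt_le_trans kT _.
by rewrite invf_div mulrC ler_wpM2r ?nrm_ge0// invf_div.
Qed.

Lemma bound_continuous (T : H -> H) (D : R) : linear T -> 0 < D ->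
  (forall x, nrm (T x) <= D * nrm x) -> continuous T.
Proof.
move=> Tl D0 HD x P /nbhs_nrm[e e0 He]; apply/nbhs_nrm.
exists (e / D) => [|y xy]; first by rewrite divr_gt0.
apply: He; rewrite -linear_sub//; apply: le_lt_trans (HD _) _.
by rewrite mulrC -ltr_pdivlMr.
Qed.

End Operators.

Section Hilbert.
Context {R : realType} {H : hilbertType R}.
Implicit Types (x y z u v : H) (r e : R).

(** With the real part, all estimates are real ones; symmetry for the full inner product is
    recovered in [ip_sym_inner]. *)
Definition ip x y : R := complex.Re (inner x y).

Lemma ipDl x y z : ip (x + y) z = ip x z + ip y z.
Proof. by rewrite /ip linearDl raddfD. Qed.

Lemma ipBl x y z : ip (x - y) z = ip x z - ip y z.
Proof. by rewrite /ip linearBl raddfB. Qed.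

Lemma ipC x y : ip x y = ip y x.
Proof.
have innerC : inner x y = (inner y x)^*%C by rewrite (hermC inner) expr0 mul1r.
by rewrite /ip innerC; case: (inner y x).
Qed.

Lemma ipDr x y z : ip x (y + z) = ip x y + ip x z.
Proof. by rewrite ipC ipDl !(ipC x). Qed.

Lemma ipBr x y z : ip x (y - z) = ip x y - ip x z.
Proof. by rewrite ipC ipBl !(ipC x). Qed.

Lemma ipZl r x y : ip (r%:C *: x) y = r * ip x y.
Proof.
have E (k : R[i]) : complex.Re (r%:C * k) = r * complex.Re k.
  by case: k => a b /=; rewrite mul0r subr0.
by rewrite /ip linearZl_LR; exact: E.
Qed.

Lemma ipZr r x y : ip x (r%:C *: y) = r * ip x y.
Proof. by rewrite ipC ipZl ipC. Qed.

Lemma ipxx x : ip x x = nrm x ^+ 2.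
Proof. by rewrite /ip -norm_inner nrmE -rmorphXn. Qed.

Lemma ip0l y : ip 0 y = 0.
Proof. by have := ipDl 0 0 y; rewrite addr0; lra. Qed.

Lemma ip0r y : ip y 0 = 0.
Proof. by rewrite ipC ip0l. Qed.

Lemma cauchy_schwarz x y : ip x y <= nrm x * nrm y.
Proof.
have [-> |x0] := eqVneq x 0.
  by rewrite nrm0 mul0r ip0l.
have nx : 0 < nrm x.
  by rewrite lt0r nrm_ge0 andbT; apply: contra_neq x0 => /nrm0_eq0.
have := sqr_ge0 (nrm ((nrm y)%:C *: x - (nrm x)%:C *: y)).
rewrite -ipxx ipBl !ipBr !ipZl !ipZr !ipxx (ipC y x).
have [y0|y0] := eqVneq (nrm y) 0.
  by have := nrm0_eq0 y0 => ->; rewrite nrm0 mulr0 ip0r.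
have ny : 0 < nrm y by rewrite lt0r y0 nrm_ge0.
move=> h; rewrite -(ler_pM2l (mulr_gt0 nx ny)); nra.
Qed.

Lemma ip_ext u v : (forall y, ip u y = ip v y) -> u = v.
Proof.
move=> h; apply/eqP; rewrite -subr_eq0; apply/eqP/nrm0_eq0/eqP.
by rewrite -sqrf_eq0 -ipxx ipBl h subrr.
Qed.

Lemma nrm_of_ip_le u e : 0 <= e -> (forall y, ip u y <= e * nrm y) -> nrm u <= e.
Proof.
move=> e0 h; have [-> //|u0] := eqVneq (nrm u) 0.
have nu : 0 < nrm u by rewrite lt0r u0 nrm_ge0.
by have := h u; rewrite ipxx expr2 ler_pM2r.
Qed.

End Hilbert.

Section Decreasing.
Context {R : realType}.

Lemma decreasing_cauchy (g : nat -> R) : (forall n, 0 <= g n) ->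
  (forall n, g n.+1 <= g n) -> forall e, 0 < e ->
  exists N, forall n m, (N <= n)%N -> (N <= m)%N -> g n - g m < e.
Proof.
move=> g0 gS e e0; have gmono n m : (n <= m)%N -> g m <= g n.
  by move=> /subnKC <-; elim: (m - n)%N => [|k IH];
    rewrite ?addn0// addnS; exact: le_trans IH.
have hg : has_inf (range g).
  by split; [exists (g 0%N); exists 0%N|exists 0 => _ [n _ <-]].
have [_ [N _ <-] HN] := inf_adherent e0 hg.
exists N => n m Nn _; have := gmono _ _ Nn.
by have := ge_inf hg.2 (ex_intro2 _ _ m I erefl : range g (g m)); lra.
Qed.

End Decreasing.

(** * Powers of 1 - h for a positive contraction h *)

Section PowersOfContraction.
Context {R : realType} {H : hilbertType R}.
Variable h : H -> H.
Hypothesis hl : linear h.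
Hypothesis hsym : forall x y, ip (h x) y = ip x (h y).
Hypothesis h0 : forall x, 0 <= ip (h x) x.
Hypothesis h1 : forall x, nrm (h x) <= nrm x.
Implicit Types (x y : H).

Definition compl_op x := x - h x.

Local Notation T := compl_op.

Let hB x y : h (x - y) = h x - h y.
Proof. exact: linear_sub. Qed.

Let Tsym x y : ip (T x) y = ip x (T y).
Proof. by rewrite ipBl ipBr hsym. Qed.

Let Tpos x : 0 <= ip (T x) x.
Proof.
rewrite ipBl ipxx subr_ge0; apply: le_trans (cauchy_schwarz _ _) _.
by rewrite expr2 ler_wpM2r ?nrm_ge0.
Qed.

Let hT x : h (T x) = T (h x).
Proof. exact: hB. Qed.

Let hTn n x : h (iter n T x) = iter n T (h x).
Proof. by elim: n x => // n IH x; rewrite !iterS hT IH. Qed.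

Lemma iter_compl_sym n x y : ip (iter n T x) y = ip x (iter n T y).
Proof. by elim: n x y => // n IH x y; rewrite iterS Tsym IH -iterSr. Qed.

(** Moving one factor [T] across leaves the form of the power lowered by two, taken at [T x]; hence
    the induction in steps of two. *)
Lemma iter_compl_pos n x : 0 <= ip (iter n T x) x.
Proof.
elim/ltn_ind: n x => -[|[|n]] IH x; first by rewrite ipxx sqr_ge0.
  exact: Tpos.
by rewrite iterS Tsym iterSr; exact: IH.
Qed.

Lemma mul_iter_compl_pos n x : 0 <= ip (h (iter n T x)) x.
Proof.
elim/ltn_ind: n x => -[|[|n]] IH x; first exact: h0.
  (* This writes h T as T h T + h T h, a sum of two positive forms. *)
  rewrite /= {2}(_ : x = T x + h x); last by rewrite subrK.
  by rewrite ipDr addr_ge0// hT.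
by rewrite iterS hT Tsym iterSr; exact: IH.
Qed.

Let muS n x : ip (iter n T x) x - ip (iter n.+1 T x) x = ip (h (iter n T x)) x.
Proof. by rewrite -ipBl iterS /T subKr. Qed.

Lemma iter_compl_decr n x : ip (iter n.+1 T x) x <= ip (iter n T x) x.
Proof. by rewrite -subr_ge0 muS mul_iter_compl_pos. Qed.

Let mul_iter_compl_decr n x :
  ip (h (iter n.+1 T x)) x <= ip (h (iter n T x)) x.
Proof.
rewrite -subr_ge0 -ipBl -hB iterS /T subKr hsym hTn.
exact: iter_compl_pos.
Qed.

(** The forms of h T^k are the successive differences of those of T^k, so n + 1 of them telescope to
    at most norm x ^ 2; being decreasing in k, the last one is at most their average. This plays the
    part of the scalar bound t (1 - t)^n <= 1 / (n + 1). *)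
Lemma mul_iter_compl_small n x :
  n.+1%:R * ip (h (iter n T x)) x <= nrm x ^+ 2.
Proof.
suff H1 : n.+1%:R * ip (h (iter n T x)) x <= nrm x ^+ 2 - ip (iter n.+1 T x) x.
  by apply: le_trans H1 _; rewrite gerBl iter_compl_pos.
elim: n => [|n IH]; first by rewrite mul1r -muS ipxx.
have := muS n.+1 x; have := mul_iter_compl_decr n x.
rewrite -(natr1 n.+1) mulrDl mul1r.
have n0 : 0 <= n.+1%:R :> R by [].
by move=> /(ler_wpM2l n0); lra.
Qed.

Lemma nrm_iter_compl_le n x : nrm (iter n T x) <= nrm x.
Proof.
elim: n => // n IH; apply: le_trans IH; rewrite iterS.
set y := iter n T x.
rewrite -(@ler_pXn2r _ 2) ?nnegrE ?nrm_ge0// -ipxx -Tsym -ipxx.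
exact: le_trans (iter_compl_decr 1 y) (iter_compl_decr 0 y).
Qed.

Lemma mul_iter_compl_form n x :
  n.+1%:R * ip (h (iter n T x)) (iter n T x) <= nrm x ^+ 2.
Proof.
apply: le_trans (mul_iter_compl_small n x); rewrite ler_pM2l ?ltr0n//.
have decr k : ip (h (iter (n + k) T x)) x <= ip (h (iter n T x)) x.
  elim: k => [|k IH]; first by rewrite addn0.
  by rewrite addnS; apply: le_trans IH; exact: mul_iter_compl_decr.
apply: le_trans (decr n).
by rewrite !hTn !iter_compl_sym -iterD.
Qed.

(** Positivity of h (1 - h) gives h^2 <= h, which turns the bound on the form into one on the
    norm. *)
Lemma nrm_mul_iter_compl n x :
  n.+1%:R * nrm (h (iter n T x)) ^+ 2 <= nrm x ^+ 2.
Proof.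
apply: le_trans (mul_iter_compl_form n x); rewrite ler_pM2l ?ltr0n//.
set y := iter n T x.
have : 0 <= ip (h (T y)) y by exact: (mul_iter_compl_pos 1 y).
by rewrite hB ipBl (hsym (h y)) ipxx subr_ge0.
Qed.

Lemma iter_compl_lim : exists Q : H -> H,
  [/\ linear Q, forall x y, ip (Q x) y = ip x (Q y),
      forall x, h (Q x) = 0, forall x, h x = 0 -> Q x = x &
      forall x e, 0 < e ->
        exists N, forall n, (N <= n)%N -> nrm (Q x - iter n T x) < e].
Proof.
have TZ k x : T (k *: x) = k *: T x.
  have h00 : h 0 = 0 by rewrite -[X in h X](subrr 0) hB subrr.
  by rewrite /T -[k *: x]addr0 hl h00 !addr0 scalerBr.
have TD x y : T (x + y) = T x + T y.
  by rewrite /T -[x]scale1r hl !scale1r opprD addrACA.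
have TnZ n k x : iter n T (k *: x) = k *: iter n T x.
  by elim: n => // n IH; rewrite !iterS IH TZ.
have TnD n x y : iter n T (x + y) = iter n T x + iter n T y.
  by elim: n => // n IH; rewrite !iterS IH TD.
have lim x : exists l, forall e : R, 0 < e ->
    exists N, forall n, (N <= n)%N -> nrm (l - iter n T x) < e.
  apply: nrm_complete => e e0.
  (* The squared distance between T^n x and T^m x is made of the forms of T^(2n), T^(n+m) and
     T^(2m): two differences of terms of a decreasing sequence, each below this bound. *)
  have e2 : 0 < e ^+ 2 / 2 by rewrite divr_gt0// exprn_gt0.
  have [N HN] := decreasing_cauchy (fun n => iter_compl_pos n x)
    (fun n => iter_compl_decr n x) e2.
  exists N => n m Nn Nm; rewrite -(@ltr_pXn2r _ 2) ?nnegrE ?nrm_ge0 ?ltW//.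
  have E k l : ip (iter k T x) (iter l T x) = ip (iter (k + l) T x) x.
    by rewrite addnC iterD [RHS]iter_compl_sym.
  rewrite -ipxx ipBl !ipBr (ipC (iter m T x) (iter n T x)) !E.
  have h1' := HN (n + n)%N (n + m)%N _ _; have h2' := HN (m + m)%N (n + m)%N _ _.
  have : (N <= n + n)%N by exact: leq_trans Nn (leq_addr _ _).
  have : (N <= m + m)%N by exact: leq_trans Nm (leq_addr _ _).
  have : (N <= n + m)%N by exact: leq_trans Nn (leq_addr _ _).
  move=> i1 i2 i3; have := h1' i3 i1; have := h2' i2 i1; lra.
have /choice[Q HQ] := lim.
exists Q; split=> //.
- move=> k x y; apply/eqP; rewrite -subr_eq0; apply/eqP; apply: nrm_le0 => e e0.
  have k0 := Re_normr_ge0 k.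
  have kp : 0 < complex.Re `|k| + 1 by rewrite ltr_wpDl.
  have [N1 H1] := HQ (k *: x + y) (e / 3) (divr_gt0 e0 (ltr0n _ 3)).
  have e3 : 0 < e / 3 / (complex.Re `|k| + 1) by rewrite !divr_gt0.
  have [N2 H2] := HQ x _ e3.
  have [N3 H3] := HQ y (e / 3) (divr_gt0 e0 (ltr0n _ 3)).
  pose n := maxn N1 (maxn N2 N3).
  have {}H1 := H1 n (leq_maxl _ _).
  have {}H2 := H2 n (leq_trans (leq_maxl _ _) (leq_maxr _ _)).
  have {}H3 := H3 n (leq_trans (leq_maxr _ _) (leq_maxr _ _)).
  have -> : Q (k *: x + y) - (k *: Q x + Q y) = (Q (k *: x + y) -
      iter n T (k *: x + y)) - (k *: (Q x - iter n T x) + (Q y - iter n T y)).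
    rewrite TnD TnZ scalerBr (addrACA (k *: Q x)) -opprD.
    by rewrite opprB addrA subrK.
  apply: le_trans (nrmB _ _) _.
  have := nrmD (k *: (Q x - iter n T x)) (Q y - iter n T y).
  have : nrm (k *: (Q x - iter n T x)) <= e / 3.
    rewrite nrmZ; move: H2; rewrite ltr_pdivlMr// => /ltW; apply: le_trans.
    by rewrite mulrC ler_wpM2l ?nrm_ge0// lerDl.
  lra.
- move=> x y; apply/eqP; rewrite eq_le; apply/andP.
  suff S x' y' : ip (Q x') y' <= ip x' (Q y').
    by split=> //; rewrite ipC (ipC (Q x)).
  apply/ler_addgt0Pl => e e0.
  pose d := e / (nrm x' + nrm y' + 1).
  have p0 : 0 < nrm x' + nrm y' + 1.
    by rewrite ltr_wpDl// addr_ge0 ?nrm_ge0.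
  have d0 : 0 < d by rewrite divr_gt0.
  have [N1 H1] := HQ x' d d0; have [N2 H2] := HQ y' d d0.
  pose n := maxn N1 N2.
  have {}H1 := H1 n (leq_maxl _ _); have {}H2 := H2 n (leq_maxr _ _).
  have := cauchy_schwarz (Q x' - iter n T x') y'.
  have := cauchy_schwarz x' (iter n T y' - Q y').
  rewrite ipBl ipBr -iter_compl_sym nrmBC => a1 a2.
  have b1 := ler_wpM2r (nrm_ge0 y') (ltW H1).
  have b2 := ler_wpM2l (nrm_ge0 x') (ltW H2).
  have dE : d * (nrm x' + nrm y' + 1) = e by rewrite /d divfK ?gt_eqF.
  by rewrite mulrDr mulrDr mulr1 in dE; lra.
- move=> x; apply: nrm_le0 => e e0.
  have e2 : 0 < e / 2 by rewrite divr_gt0.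
  have e8 : 0 < e ^+ 2 / 4 by rewrite divr_gt0// exprn_gt0.
  have [N1 H1] := HQ x (e / 2) e2.
  have [N2 H2] := exists_natM_gt (nrm x ^+ 2) e8.
  pose n := maxn N1 N2.
  have {}H1 := H1 n (leq_maxl _ _).
  rewrite -[h _](subrK (h (iter n T x))) -hB.
  apply: le_trans (nrmD _ _) _.
  have := h1 (Q x - iter n T x).
  suff : nrm (h (iter n T x)) <= e / 2 by lra.
  rewrite -(@ler_pXn2r _ 2) ?nnegrE ?nrm_ge0 ?(ltW e2)//.
  have nN : n.+1%:R * (e ^+ 2 / 4) > nrm x ^+ 2.
    apply: lt_le_trans H2 _; rewrite ler_wpM2r ?(ltW e8)// ler_nat.
    exact: leq_trans (leq_maxr _ _) (leqnSn _).
  have n1 : 0 < n.+1%:R :> R by rewrite ltr0n.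
  rewrite -(ler_pM2l n1) expr_div_n -natrX; apply: le_trans (ltW nN).
  exact: nrm_mul_iter_compl.
- move=> x hx; have Tx n : iter n T x = x.
    by elim: n => // n IH; rewrite iterS IH /T hx subr0.
  apply/eqP; rewrite -subr_eq0; apply/eqP; apply: nrm_le0 => e e0.
  by have [N /(_ N (leqnn _))] := HQ x e e0; rewrite Tx => /ltW.
Qed.

End PowersOfContraction.

(** * The universal representation *)

Lemma closure_subspace {R : realType} {V : normedModType R[i]} (W : set V) :
  W 0 -> (forall (c : R[i]) x y, W x -> W y -> W (c *: x + y)) ->
  closed_subspace [set z | forall e : R, 0 < e -> exists2 w, W w & nrm (z - w) < e].
Proof.
move=> W0 Wl; split.
- apply/closed_nrmP => x Hx e e0; have e2 : 0 < e / 2 by rewrite divr_gt0.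
  have [w /(_ _ e2)[v Wv wv] xw] := Hx _ e2; exists v => //.
  by apply: le_lt_trans (nrm_triangle w _ _) _; lra.
- by move=> e e0; exists 0 => //; rewrite subr0 nrm0.
- move=> c x y Hx Hy e e0; have e2 : 0 < e / 2 by rewrite divr_gt0.
  have c0 := Re_normr_ge0 c.
  have cp : 0 < complex.Re `|c| + 1 by rewrite ltr_wpDl.
  have [w Ww xw] := Hx _ (divr_gt0 e2 cp); have [v Wv yv] := Hy _ e2.
  exists (c *: w + v); first exact: Wl.
  rewrite opprD addrACA -scalerBr; apply: le_lt_trans (nrmD _ _) _.
  move: xw; rewrite nrmZ ltr_pdivlMr// mulrDr mulr1 mulrC.
  by have := nrm_ge0 (x - w); lra.
Qed.

Lemma state_le {R : realType} {A : cstarAlgType R} (phi : A -> R[i]) a :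
  is_state phi -> complex.Re (phi a) <= nrm a.
Proof.
move=> [phis _ [ub _]]; have phi0 := scalar_eq0 phis.
have phiZ k b := scalar_mul k b phis.
have Re_le (z : R[i]) : complex.Re z <= complex.Re `|z|.
  have := normc_ge_Re z; rewrite -[`|z|](RRe_real (normr_real z)) lecR.
  exact: le_trans (ler_norm _).
have [na0|a0] := eqVneq (nrm a) 0.
  by rewrite (nrm0_eq0 na0) phi0 nrm0.
have na : 0 < nrm a by rewrite lt0r a0 nrm_ge0.
have : `|phi ((nrm a)^-1%:C *: a)| <= 1.
  apply: ub; exists ((nrm a)^-1%:C *: a) => //=.
  by rewrite nrmE nrmZp ?invr_ge0 ?nrm_ge0// mulVf.
rewrite phiZ normrM -[`|phi a|](RRe_real (normr_real _)).
rewrite ger0_norm; last by rewrite ler0c invr_ge0 nrm_ge0.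
rewrite -rmorphM/= lecR ler_pdivrMl// mulr1 => /(le_trans (Re_le _)).
exact.
Qed.

Section Representation.
Context {R : realType} {A : cstarAlgType R} {H : hilbertType R}.
Variable rho : A -> H -> H.
Hypothesis rho_univ : is_universal_representation rho.
Implicit Types (a b c : A) (x y z : H) (r e t : R).

Lemma rho_linear a : linear (rho a).
Proof. by case: rho_univ => -[+ _ _ _] _ => /(_ a)[]. Qed.

Lemma rhoDr a x y : rho a (x + y) = rho a x + rho a y.
Proof. by rewrite -[x]scale1r rho_linear !scale1r. Qed.

Lemma rhoBr a x y : rho a (x - y) = rho a x - rho a y.
Proof. exact: linear_sub (rho_linear a). Qed.

Lemma rho0r a : rho a 0 = 0.
Proof. exact: linear_eq0 (rho_linear a). Qed.

Lemma rhoZr a k x : rho a (k *: x) = k *: rho a x.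
Proof. exact: linear_scale (rho_linear a). Qed.

Lemma rhoP (k : R[i]) a b x : rho (k *: a + b) x = k *: rho a x + rho b x.
Proof. by case: rho_univ => -[]. Qed.

Lemma rhoDl a b x : rho (a + b) x = rho a x + rho b x.
Proof. by have := rhoP 1 a b x; rewrite !scale1r. Qed.

Lemma rho0l x : rho 0 x = 0.
Proof. by apply: (addIr (rho 0 x)); rewrite -rhoDl !add0r. Qed.

Lemma rhoZl (k : R[i]) a x : rho (k *: a) x = k *: rho a x.
Proof. by have := rhoP k a 0 x; rewrite rho0l !addr0. Qed.

Lemma rhoNl a x : rho (- a) x = - rho a x.
Proof. by rewrite -scaleN1r rhoZl scaleN1r. Qed.

Lemma rhoBl a b x : rho (a - b) x = rho a x - rho b x.
Proof. by rewrite rhoDl rhoNl. Qed.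

Lemma rhoM a b x : rho (a ** b) x = rho a (rho b x).
Proof. by case: rho_univ => -[]. Qed.

Lemma rho_adj a x y : ip (rho a x) y = ip x (rho a^# y).
Proof. by case: rho_univ => -[_ _ _ adj] _; rewrite /ip adj. Qed.

Lemma rho_bound a : exists2 D : R, 0 < D & forall x, nrm (rho a x) <= D * nrm x.
Proof.
case: rho_univ => -[+ _ _ _] _ => /(_ a)[]; exact: bounded_operator_bound.
Qed.

Lemma ip_rho_starM a x y : ip (rho (a^# ** a) x) y = ip (rho a x) (rho a y).
Proof. by rewrite rhoM rho_adj cstarK. Qed.

(** Universality is used in this form: states are vector states, and the vectors [rho b (xi phi)]
    span a dense subspace. *)
Lemma state_vector : exists xi : (A -> R[i]) -> H,
  (forall phi, is_state phi -> forall a, phi a = inner (rho a (xi phi)) (xi phi)) /\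
  (forall W : set H, closed_subspace W ->
     (forall phi b, is_state phi -> W (rho b (xi phi))) -> forall z, W z).
Proof.
case: rho_univ => _ [xi [_ Hphi _ Hspan]]; exists xi; split=> // W cW HW z.
have : setT z by []; rewrite -Hspan => /(_ W); apply; split=> // y [phi sphi].
by apply; split=> // _ [b _ <-]; exact: HW.
Qed.

(** On a vector b xi the powers of [G] act through those of [g] on [A], and vector states are
    contractive, so they grow at most like t^n. Log-convexity turns this growth into the bound by
    [t], which extends to all of [H] by density. *)
Lemma rho_multiplier_bound c r t : c^# = c -> 0 <= r -> 0 <= t ->
  (forall y : A, nrm (r%:C *: y + c ** y) <= t * nrm y) ->
  forall z, nrm (r%:C *: z + rho c z) <= t * nrm z.
Proof.
move=> csa r0 t0 Hc; pose G z := r%:C *: z + rho c z.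
pose g b : A := r%:C *: b + c ** b.
have Gl (k : R[i]) x y : G (k *: x + y) = k *: G x + G y.
  rewrite /G rhoDr rhoZr !scalerDr !scalerA mulrC -!addrA; congr (_ + _).
  by rewrite addrCA.
have Gnl n (k : R[i]) x y :
    iter n G (k *: x + y) = k *: iter n G x + iter n G y.
  by elim: n => // n IH; rewrite !iterS IH Gl.
have Gsym x y : ip (G x) y = ip x (G y).
  by rewrite /G ipDl ipDr ipZl ipZr rho_adj csa.
have Gsq x : nrm (G x) ^+ 2 <= nrm x * nrm (G (G x)).
  by rewrite -ipxx Gsym; exact: cauchy_schwarz.
(* The inequality wanted for [G] is not stable under sums of vectors; growth of order t^n with an
   arbitrary constant is, so the argument runs on this subspace. *)
pose W0 := [set z | exists C, forall n, nrm (iter n G z) <= C * t ^+ n].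
have W0b z : W0 z -> nrm (G z) <= t * nrm z.
  move=> [C HC]; apply: (@log_convex_le R (fun n => nrm (iter n G z)) C) => // n.
  - exact: nrm_ge0.
  - exact: Gsq.
have W00 : W0 0.
  exists 0 => n; suff -> : iter n G 0 = 0 by rewrite nrm0 mul0r.
  by elim: n => // n IH; rewrite iterS IH /G scaler0 rho0r addr0.
have W0l (k : R[i]) x y : W0 x -> W0 y -> W0 (k *: x + y).
  move=> [C HC] [D HD]; exists (complex.Re `|k| * C + D) => n; rewrite Gnl.
  apply: le_trans (nrmD _ _) _; rewrite mulrDl lerD// nrmZ -mulrA.
  by rewrite ler_wpM2l// Re_normr_ge0.
have [xi [Hphi Hspan]] := state_vector.
have [D D0 HD] := rho_bound c.
have GD z : nrm (G z) <= (r + D) * nrm z.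
  apply: le_trans (nrmD _ _) _; rewrite mulrDl lerD//.
  by rewrite nrmZp.
move=> z; have Hz := Hspan _ (closure_subspace W00 W0l) _ z.
apply/ler_addgt0Pl => e e0.
have p0 : 0 < r + D + t + 1 by rewrite ltr_wpDl// !addr_ge0// ltW.
have [||w Ww zw] := Hz _ (e / (r + D + t + 1)); last 1 first.
- have GB : G z = G (z - w) + G w.
    by have := Gl 1 (z - w) w; rewrite !scale1r subrK.
  rewrite -/(G z) GB; apply: le_trans (nrmD _ _) _.
  have := GD (z - w); have := W0b w Ww.
  have : nrm w <= nrm z + nrm (z - w).
    by have := nrmB z (z - w); rewrite subKr.
  move=> /(ler_wpM2l t0).
  move: zw; rewrite ltr_pdivlMr// => zw; have := nrm_ge0 (z - w); lra.
- move=> phi b sphi e' e'0; exists (rho b (xi phi)); last first.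
    by rewrite subrr nrm0.
  exists (nrm b) => n.
  have -> : iter n G (rho b (xi phi)) = rho (iter n g b) (xi phi).
    by elim: n => // n IH; rewrite !iterS IH /G /g rhoP rhoM.
  apply: le_trans (_ : nrm (iter n g b) <= _).
    rewrite -(@ler_pXn2r _ 2) ?nnegrE ?nrm_ge0// -ipxx -ip_rho_starM.
    rewrite /ip -Hphi// -nrm_starM; exact: state_le.
  elim: n => [|n IH]; first by rewrite expr0 mulr1.
  rewrite iterS; apply: le_trans (Hc _) _.
  by rewrite exprS mulrCA ler_wpM2l.
- by rewrite divr_gt0.
Qed.

Lemma nrm_rho a x : nrm (rho a x) <= nrm a * nrm x.
Proof.
have := @rho_multiplier_bound (a^# ** a) 0 (nrm a ^+ 2) (cstar_pos a) (lexx _).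
move=> /(_ (sqr_ge0 _)) h.
have {}h : nrm (rho (a^# ** a) x) <= nrm a ^+ 2 * nrm x.
  have -> : rho (a^# ** a) x = 0%:C *: x + rho (a^# ** a) x by rewrite scale0r add0r.
  by apply: h => y; rewrite scale0r add0r -nrm_starM; exact: nrmM.
rewrite -(@ler_pXn2r _ 2) ?nnegrE ?mulr_ge0 ?nrm_ge0// -ipxx -ip_rho_starM.
apply: le_trans (cauchy_schwarz _ _) _; rewrite exprMn (expr2 (nrm x)) mulrA.
by rewrite ler_wpM2r ?nrm_ge0.
Qed.

Lemma dominated_rho e c x : 0 <= e -> c^# = c -> dominated e c ->
  ip (rho c x) x <= e * nrm x ^+ 2.
Proof.
move=> e0 csa [r r0 Hr].
have h := rho_multiplier_bound csa r0 (addr_ge0 r0 e0) Hr x.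
have := cauchy_schwarz (r%:C *: x + rho c x) x.
rewrite ipDl ipZl ipxx => h'; have := ler_wpM2r (nrm_ge0 x) h; lra.
Qed.

(** States are nonpositive on w = s^2 - C^2 s with s = a^2, so [dominated_of_states] with B = {0}
    gives w <= e for all e > 0. Thus s^2 <= C^2 s up to e, and norm s <= C^2. The factor s stands in
    for a unit: C^2 - s itself is not in [A]. *)
Lemma rho_isometric_selfadjoint a C : a^# = a -> 0 <= C ->
  (forall x, nrm (rho a x) <= C * nrm x) -> nrm a <= C.
Proof.
move=> asa C0 Ha; have [-> //|a0] := eqVneq (nrm a) 0.
have na : 0 < nrm a by rewrite lt0r a0 nrm_ge0.
pose s := a ** a; have ssa : s^# = s by rewrite cstarM asa.
have ns : nrm s = nrm a ^+ 2 by rewrite -nrm_starM asa.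
pose w := s ** s - (C ^+ 2)%:C *: s.
have [xi [Hphi _]] := state_vector.
have Hw (phi : A -> R[i]) : is_state phi ->
    (forall b, [set 0 : A] b -> phi b = 0) -> complex.Re (phi w) <= 0.
  move=> sphi _; rewrite Hphi// -/(ip _ _) rhoBl ipBl rhoZl ipZl.
  have E1 z : ip (rho s z) z = nrm (rho a z) ^+ 2.
    by rewrite -ipxx -ip_rho_starM asa.
  have E2 z : ip (rho (s ** s) z) z = nrm (rho a (rho a z)) ^+ 2.
    by rewrite -ipxx -rhoM -{1}ssa ip_rho_starM.
  rewrite E1 E2 subr_le0 -exprMn.
  by rewrite ler_pXn2r ?nnegrE ?mulr_ge0 ?nrm_ge0.
have wsa : w^# = w by rewrite cstarB cstarZr cstarM ssa.
have bound e : 0 < e -> nrm s <= Num.sqrt (e + C ^+ 2 * nrm s).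
  move=> e0; have [b ->] : exists2 b, [set 0 : A] b & dominated e (w + b).
    apply: dominated_of_states wsa Hw e e0 => //.
    - by move=> _ _ -> ->; rewrite addr0.
    - by move=> r _ ->; rewrite scaler0.
    - by move=> _ ->; rewrite cstar0.
  rewrite addr0 => Hd.
  have := dominatedD Hd (dominatedZ (sqr_ge0 C) (dominated_nrm s)).
  rewrite subrK => -[r r0 Hr].
  have Hb : bnd (r + (e + C ^+ 2 * nrm s)) (lconst r + lmult s * lmult s).
    by move=> y; have := Hr y; rewrite -cmulA.
  have sl : selfadjoint (lmult s) by rewrite /selfadjoint -lmult_star ssa.
  have p0 : 0 <= e + C ^+ 2 * nrm s.
    by rewrite addr_ge0 ?(ltW e0)// mulr_ge0 ?sqr_ge0 ?nrm_ge0.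
  have := bnd_of_const_add_sqr sl r0 p0 Hb s.
  rewrite /= -{1}ssa nrm_starM expr2 ler_pM2r// ns exprn_gt0//.
have ss : nrm s ^+ 2 <= C ^+ 2 * nrm s.
  apply/ler_addgt0Pl => e e0; have := bound e e0.
  rewrite -(@ler_pXn2r _ 2) ?nnegrE ?nrm_ge0 ?sqrtr_ge0// sqr_sqrtr//.
  by rewrite addr_ge0 ?(ltW e0)// mulr_ge0 ?sqr_ge0 ?nrm_ge0.
have s0 : 0 < nrm s by rewrite ns exprn_gt0.
have : nrm s <= C ^+ 2 by rewrite -(ler_pM2r s0) -expr2.
by rewrite ns ler_pXn2r// nnegrE nrm_ge0.
Qed.

Lemma rho_isometric a C : 0 <= C ->
  (forall x, nrm (rho a x) <= C * nrm x) -> nrm a <= C.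
Proof.
move=> C0 Ha; rewrite -(@ler_pXn2r _ 2) ?nnegrE ?nrm_ge0// -nrm_starM.
apply: rho_isometric_selfadjoint (cstar_pos a) (sqr_ge0 C) _ => x.
apply: nrm_of_ip_le => [|y]; first by rewrite mulr_ge0 ?sqr_ge0 ?nrm_ge0.
rewrite ip_rho_starM; apply: le_trans (cauchy_schwarz _ _) _.
apply: le_trans (ler_pM (nrm_ge0 _) (nrm_ge0 _) (Ha x) (Ha y)) _.
by rewrite expr2; lra.
Qed.

End Representation.

(** * Corners *)

Section Corner.
Context {R : realType} {A : cstarAlgType R} {H : hilbertType R}.
Variable rho : A -> H -> H.
Hypothesis rho_univ : is_universal_representation rho.
Implicit Types (a b c : A) (x y z v : H) (p q : H -> H) (r e t : R).

Definition orthoproj p :=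
  [/\ linear p, forall x, p (p x) = p x & forall x y, ip (p x) y = ip x (p y)].

Lemma bidual_orthoproj p : bidual_projection rho p -> orthoproj p.
Proof. by case=> -[[pl _] _] pp psym; split=> // x y; rewrite /ip psym. Qed.

Lemma orthoprojB p x y : orthoproj p -> p (x - y) = p x - p y.
Proof. by case=> pl _ _; exact: linear_sub. Qed.

Lemma orthoproj0 p : orthoproj p -> p 0 = 0.
Proof. by case=> pl _ _; exact: linear_eq0. Qed.

Lemma orthoproj_form p x : orthoproj p -> ip (p x) x = nrm (p x) ^+ 2.
Proof. by case=> _ pp psym; rewrite -ipxx -[RHS]psym pp. Qed.

Lemma orthoproj_nrm p x : orthoproj p -> nrm (p x) <= nrm x.
Proof.
move=> op; have [-> |p0] := eqVneq (nrm (p x)) 0; first exact: nrm_ge0.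
have := cauchy_schwarz (p x) x; rewrite orthoproj_form// expr2 ler_pM2l//.
by rewrite lt0r p0 nrm_ge0.
Qed.

Lemma proj_leP p q : orthoproj p -> orthoproj q -> proj_le p q ->
  forall x, q x = 0 -> p x = 0.
Proof.
move=> op oq pq x qx; apply/nrm0_eq0/eqP; rewrite -sqrf_eq0 eq_le sqr_ge0 andbT.
rewrite -orthoproj_form//.
have := pq x; rewrite lecE => /andP[_]; rewrite -/(ip _ _) -/(ip (q x) x).
by rewrite qx ip0l.
Qed.

Lemma hereditary_ofP p a : (forall x, p (p x) = p x) ->
  hereditary_of rho p a <-> forall x, rho a x = p (rho a (p x)).
Proof.
move=> pp; split=> [[T _ aT] x|h]; first by rewrite aT /= !pp.
exists (rho a); last by apply/funext => x /=; rewrite -h.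
by split; [case: rho_univ => -[]|apply: subset_closure; exists a].
Qed.

Lemma hereditary_of_selfadjoint p a : orthoproj p -> a^# = a ->
  (forall v, p v = 0 -> rho a v = 0) -> hereditary_of rho p a.
Proof.
move=> op asa h; have [pl pp psym] := op; apply/hereditary_ofP => // x.
have E v : rho a v = rho a (p v).
  apply/eqP; rewrite -subr_eq0 -(rhoBr rho_univ) h//.
  by rewrite orthoprojB// pp subrr.
rewrite -E; apply: ip_ext => y.
by rewrite psym !(rho_adj rho_univ) asa -E.
Qed.

Lemma rho_star_mul_eq0 a v : ip (rho (a^# ** a) v) v = 0 -> rho a v = 0.
Proof.
rewrite (ip_rho_starM rho_univ) ipxx => /eqP.
by rewrite sqrf_eq0 => /eqP/nrm0_eq0.
Qed.

Lemma hereditary_of_subalgebra p : orthoproj p ->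
  hereditary_cstar_subalgebra (hereditary_of rho p).
Proof.
move=> op; have [pl pp psym] := op; split.
- split.
  + apply/closed_nrmP => a Ha; apply/hereditary_ofP => // x.
    apply/eqP; rewrite -subr_eq0; apply/eqP; apply: nrm_le0 => e e0.
    have p0 : 0 < 2 * (nrm x + 1).
      by rewrite mulr_gt0// ltr_wpDl// nrm_ge0.
    have [w /hereditary_ofP -/(_ pp) Hw aw] := Ha _ (divr_gt0 e0 p0).
    have -> : rho a x - p (rho a (p x)) =
        rho (a - w) x - p (rho (a - w) (p x)).
      rewrite !(rhoBl rho_univ) orthoprojB// -Hw opprB addrA.
      by rewrite subrK.
    apply: le_trans (nrmB _ _) _.
    have b1 := nrm_rho rho_univ (a - w) x.
    have b2 := nrm_rho rho_univ (a - w) (p x).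
    have b3 := orthoproj_nrm (rho (a - w) (p x)) op.
    have b4 := ler_wpM2l (nrm_ge0 (a - w)) (orthoproj_nrm x op).
    move: aw; rewrite ltr_pdivlMr// => aw.
    have := nrm_ge0 (a - w); lra.
  + by apply/hereditary_ofP => // x; rewrite !(rho0l rho_univ) orthoproj0.
  + move=> k a b /hereditary_ofP -/(_ pp) ha /hereditary_ofP -/(_ pp) hb.
    by apply/hereditary_ofP => // x; rewrite !(rhoP rho_univ) pl -ha -hb.
- move=> a b /hereditary_ofP -/(_ pp) ha /hereditary_ofP -/(_ pp) hb.
  apply/hereditary_ofP => // x; rewrite !(rhoM rho_univ).
  by rewrite ha [in RHS]ha pp hb pp.
- move=> a /hereditary_ofP -/(_ pp) ha; apply/hereditary_ofP => // x.
  by apply: ip_ext => y; rewrite psym !(rho_adj rho_univ) cstarK psym -ha.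
- move=> _ b [x ->] [z xz] /hereditary_ofP -/(_ pp) hb.
  apply: hereditary_of_selfadjoint => //; first exact: cstar_pos.
  move=> v pv; rewrite (rhoM rho_univ).
  suff -> : rho x v = 0 by rewrite rho0r.
  (* [b] is a sum of z^* z and x^* x, both with nonnegative forms, and its own form vanishes at
     [v]. *)
  apply: rho_star_mul_eq0; apply/eqP; rewrite eq_le; apply/andP; split.
    have : ip (rho b v) v = 0 by rewrite hb psym pv ip0r.
    have -> : b = z^# ** z + x^# ** x by rewrite -xz subrK.
    rewrite (rhoDl rho_univ) ipDl (ip_rho_starM rho_univ z) ipxx.
    by have := sqr_ge0 (nrm (rho z v)); lra.
  by rewrite (ip_rho_starM rho_univ) ipxx sqr_ge0.
Qed.

Lemma hereditary_of_mono p q : orthoproj p -> orthoproj q -> proj_le p q ->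
  hereditary_of rho p `<=` hereditary_of rho q.
Proof.
move=> op oq pq a; have [_ pp psym] := op; have [_ qq qsym] := oq.
move=> /hereditary_ofP -/(_ pp) ha; apply/hereditary_ofP => // x.
have pqx v : p (q v) = p v.
  apply/eqP; rewrite eq_sym -subr_eq0 -orthoprojB//; apply/eqP.
  by apply: (proj_leP op oq pq); rewrite orthoprojB// qq subrr.
have qpx v : q (p v) = p v.
  by apply: ip_ext => y; rewrite qsym !psym pqx.
by rewrite ha [in RHS]ha pqx qpx.
Qed.

End Corner.

(** * Hereditary subalgebras *)

Section HereditarySubalgebra.
Context {R : realType} {A : cstarAlgType R}.
Variable B : set A.
Hypothesis HB : hereditary_cstar_subalgebra B.
Implicit Types (a b c f g x y : A) (r e t : R).

Lemma hereditary_lin (k : R[i]) a b : B a -> B b -> B (k *: a + b).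
Proof. by case: HB => -[_ _ + _ _ _]; apply. Qed.

Lemma hereditary0 : B 0.
Proof. by case: HB => -[]. Qed.

Lemma hereditaryD a b : B a -> B b -> B (a + b).
Proof. by move=> Ba Bb; rewrite -[a]scale1r; exact: hereditary_lin. Qed.

Lemma hereditaryZ (k : R[i]) a : B a -> B (k *: a).
Proof.
by move=> Ba; rewrite -[k *: a]addr0; exact: hereditary_lin hereditary0.
Qed.

Lemma hereditaryB a b : B a -> B b -> B (a - b).
Proof.
by move=> Ba Bb; rewrite addrC -scaleN1r; exact: hereditary_lin.
Qed.

Lemma hereditaryM a b : B a -> B b -> B (a ** b).
Proof. by case: HB => _ + _ _; apply. Qed.

Lemma hereditary_star a : B a -> B a^#.
Proof. by case: HB => _ _ + _; apply. Qed.

(** The operator norm a + 1 - a on [A] has a self-adjoint square root [m], and the element is (m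
    b)^* (m b): [m] need not come from [A], but [m b] lies in it. The 1 provides the strict
    inequality of [sqrt_shift]. *)
Lemma cpos_norm_sub a b : a^# = a ->
  cpos ((nrm a + 1)%:C *: (b^# ** b) - b^# ** a ** b).
Proof.
move=> asa; have sl : selfadjoint (lmult a) by rewrite /selfadjoint -lmult_star asa.
have [||m [sm mm _ _]] := sqrt_shift (selfadjointB (selfadjoint_const (nrm a + 1)) sl)
  (_ : 0 <= nrm a < nrm a + 1).
- by rewrite nrm_ge0/= ltrDl.
- by move=> y; rewrite subKr; exact: nrmM.
exists (m b); rewrite lopP -[ladj m _]/(lstar m _) sm -lmulE mm lsubE lconstE /=.
by rewrite cmulBr cmulZr cmulA.
Qed.

Lemma hereditary_sandwich_selfadjoint a b : a^# = a -> B b -> B (b^# ** a ** b).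
Proof.
move=> asa Bb; pose M := nrm a + 1; pose d := M%:C *: (b^# ** b).
have Bd : B d by apply: hereditaryZ; apply: hereditaryM => //; exact: hereditary_star.
have : B (d - b^# ** a ** b).
  (* Both 0 <= d - b^* a b and d - b^* a b <= 2 d are instances of [cpos_norm_sub], the second one
     for [- a]. *)
  case: HB => _ _ _ her; apply: (her _ (d + d)); last exact: hereditaryD.
    exact: cpos_norm_sub.
  rewrite /cle opprB addrACA subrr addr0; have nasa : (- a)^# = - a.
    by rewrite cstarN asa.
  by have := cpos_norm_sub b nasa; rewrite nrmN cmulNr cmulNl opprK.
by move=> /(hereditaryB Bd); rewrite subKr.
Qed.

Lemma hereditary_sandwich a b : B b -> B (b^# ** a ** b).
Proof.
move=> Bb; rewrite [a]cartesian cmulZr cmulZl cmulBr cmulBl cmulZr cmulZl.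
apply: hereditaryZ; apply: hereditaryB; last apply: hereditaryZ;
  apply: hereditary_sandwich_selfadjoint => //.
- exact: cartesian_re.
- exact: cartesian_im.
Qed.

(** Polarization: the case f = g is [hereditary_sandwich], and expanding it at f + g and at f + i g
    isolates f^* a g. *)
Lemma hereditary_bimodule a f g : B f -> B g -> B (f^# ** a ** g).
Proof.
move=> Bf Bg; have Q u : B u -> B (f^# ** a ** u + u^# ** a ** f).
  move=> Bu; have := hereditary_sandwich a (hereditaryD Bf Bu).
  rewrite cstarD !cmulDl !cmulDr => h.
  have := hereditaryB (hereditaryB h (hereditary_sandwich a Bf))
    (hereditary_sandwich a Bu).
  congr (B _).
  by rewrite addrAC addrA addrK -(addrA (_ ** f)) addrC addKr.
have h1 := Q _ Bg; have := Q _ (hereditaryZ 'i%C Bg).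
rewrite cmulZr cstarZ !cmulZl conj_i scaleNr -scalerBr => /(hereditaryZ 'i%C).
rewrite scalerA -expr2 sqr_i scaleN1r opprB => h2.
have := hereditaryZ 2^-1%:C (hereditaryB h1 h2); congr (B _).
rewrite opprB addrACA subrr addr0.
rewrite scalerDr -scalerDl -rmorphD/= (_ : 2^-1 + 2^-1 = 1 :> R); last lra.
by rewrite scale1r.
Qed.

Lemma hereditary_of_approx a :
  (forall e, 0 < e -> exists2 f, B f & nrm (a - a ** f) < e) ->
  (forall e, 0 < e -> exists2 f, B f & nrm (a^# - a^# ** f) < e) -> B a.
Proof.
move=> Hr Hl; case: HB => -[/closed_nrmP cB _ _ _ _ _]; apply: cB => e e0.
have e2 : 0 < e / 2 by rewrite divr_gt0.
have [f Bf af] := Hr _ e2; have fp : 0 < nrm f + 1 by rewrite ltr_wpDl ?nrm_ge0.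
(* [g] is chosen after [f], because its error is multiplied by [f]. *)
have [g Bg ag] := Hl _ (divr_gt0 e2 fp).
exists (g^# ** a ** f); first exact: hereditary_bimodule.
rewrite (_ : _ - _ = (a - a ** f) + (a - g^# ** a) ** f); last first.
  by rewrite cmulBl addrA subrK.
apply: le_lt_trans (nrmD _ _) _; have := nrmM (a - g^# ** a) f.
have -> : nrm (a - g^# ** a) = nrm (a^# - a^# ** g).
  by rewrite -nrm_star cstarB cstarM cstarK.
move: ag; rewrite ltr_pdivlMr// => ag; have := nrm_ge0 (a^# - a^# ** g); lra.
Qed.

(** The dense set [D] may miss [B] altogether. So for each d in [D] and each m, a point of [B]
    within 1 / (m + 1) of d is selected when there is one; the pairs are coded by integers. *)
Lemma separable_dense_seq : separable_space A ->
  exists u : nat -> A, (forall n, B (u n)) /\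
    forall b e, B b -> 0 < e -> exists n, nrm (b - u n) < e.
Proof.
move=> [D [/countable_injP[f finj] dD]].
pose good (im : nat * nat) :=
  [set b | B b /\ exists2 d, D d /\ f d = im.1 & nrm (b - d) < im.2.+1%:R^-1].
(* When no point of [B] is close enough, the default 0 keeps the sequence in [B]. *)
pose u n := xget 0 (good (odflt (0%N, 0%N) (unpickle n))).
exists u; split=> [n|b e Bb e0].
  by rewrite /u; case: xgetP => [_ -> []//|_]; exact: hereditary0.
have [m Hm] := exists_natM_gt 2 e0.
have mp : 0 < m.+1%:R :> R by rewrite ltr0n.
have me : 2 * m.+1%:R^-1 < e.
  rewrite ltr_pdivrMr//; apply: lt_le_trans Hm _.
  by rewrite [leRHS]mulrC ler_wpM2r ?(ltW e0)// ler_nat.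
have [|d [/= bd Dd]] := dD [set y | nrm (b - y) < m.+1%:R^-1]° _ (open_interior _).
  by exists b; apply/nbhs_nrm; exists m.+1%:R^-1; rewrite ?invr_gt0.
have {}bd : nrm (b - d) < m.+1%:R^-1 by exact: (nbhs_singleton bd).
exists (pickle (f d, m)); rewrite /u pickleK /=.
case: xgetP => [y _ [By [d' [Dd' fd] yd]]|/(_ b)]; last first.
  by case; split=> //; exists d.
have dd : d' = d by apply: finj => //; rewrite inE.
rewrite dd in yd; apply: le_lt_trans (nrm_triangle d _ _) _.
rewrite (nrmBC d); move: bd yd me => /=; move: (m.+1%:R^-1) => i; lra.
Qed.

End HereditarySubalgebra.

(** * Support projections *)

Lemma ip_sym_inner {R : realType} {H : hilbertType R} (T : H -> H) :
  linear T -> (forall x y, ip (T x) y = ip x (T y)) ->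
  forall x y, inner (T x) y = inner x (T y).
Proof.
move=> Tl Ts x y.
have ReI (u v : H) : ip ('i%C *: u) v = - complex.Im (inner u v).
  have E (w : R[i]) : complex.Re ('i%C * w) = - complex.Im w.
    by case: w => a b /=; rewrite mul0r mul1r add0r.
  by rewrite /ip linearZl_LR; exact: E.
apply/eqP; rewrite eq_complex; apply/andP; split; apply/eqP; first exact: Ts.
by apply: oppr_inj; rewrite -!ReI -linear_scale// Ts.
Qed.

Section SupportProjection.
Context {R : realType} {A : cstarAlgType R} {H : hilbertType R}.
Variable rho : A -> H -> H.
Hypothesis rho_univ : is_universal_representation rho.
Variable B : set A.
Hypothesis HB : hereditary_cstar_subalgebra B.
Implicit Types (a b c f g h x y : A) (z v w : H) (r e t : R).

Let B0 := hereditary0 HB.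
Let BD := hereditaryD HB.
Let BZ := hereditaryZ HB.
Let BB := hereditaryB HB.
Let BM := hereditaryM HB.
Let Bstar := hereditary_star HB.

Section UnitInterval.
Variable h : A.
Hypothesis hsa : h^# = h.
Hypothesis hpos : forall z, 0 <= ip (rho h z) z.
Hypothesis h1 : nrm h <= 1.

Let hsym z v : ip (rho h z) v = ip z (rho h v).
Proof. by rewrite (rho_adj rho_univ) hsa. Qed.

Let hle z : nrm (rho h z) <= nrm z.
Proof.
apply: le_trans (nrm_rho rho_univ h z) _.
by rewrite -[leRHS]mul1r ler_wpM2r ?nrm_ge0.
Qed.

(* 1 - (1 - h)^n, expanded so that it makes sense in A *)
Definition approx_unit n := iter n (fun f => f + (h - h ** f)) (0 : A).

Lemma approx_unit_in n : B h -> B (approx_unit n).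
Proof.
move=> Bh; elim: n => // n IH; rewrite /approx_unit iterS; apply: BD => //.
by apply: BB => //; exact: BM.
Qed.

Lemma rho_approx_unit n z :
  rho (approx_unit n) z = z - iter n (compl_op (rho h)) z.
Proof.
elim: n => [|n IH]; first by rewrite /= (rho0l rho_univ) subrr.
rewrite /approx_unit iterS -/(approx_unit n) (rhoDl rho_univ) (rhoBl rho_univ).
rewrite (rhoM rho_univ) IH (rhoBr rho_univ) subKr iterS; set t := iter n _ _.
by rewrite -[compl_op _ t]/(t - rho h t) opprB -addrA (addrC (- t)).
Qed.

Lemma range_projection : exists q, [/\ bidual_projection rho q,
  forall z, rho h z = 0 -> q z = 0 & forall z, rho h (z - q z) = 0].
Proof.
have [Q [Ql Qsym hQ Qfix Qlim]] :=
  iter_compl_lim (rho_linear rho_univ h) hsym hpos hle.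
pose q z := z - Q z.
have QZ (k : R[i]) z v : q (k *: z + v) = k *: q z + q v.
  by rewrite /q Ql scalerBr opprD addrACA.
have qsym z v : ip (q z) v = ip z (q v) by rewrite ipBl ipBr Qsym.
have QQ z : Q (Q z) = Q z by apply: Qfix; exact: hQ.
have qq z : q (q z) = q z.
  rewrite /q; have -> : Q (z - Q z) = 0.
    by rewrite addrC -scaleN1r Ql QQ scaleN1r addNr.
  by rewrite subr0.
have oq : orthoproj q by split.
exists q; split=> //; last 2 first.
- by move=> z hz; rewrite /q Qfix// subrr.
- by move=> z; rewrite /q subKr; exact: hQ.
split=> //; last by apply: ip_sym_inner => //.
split; first split=> //.
  apply: (@bound_continuous _ _ q 1) => // z; rewrite mul1r.
  exact: orthoproj_nrm.
move=> N Nq.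
(* That [q] is a strong limit of elements of [rho A] is what places it in the bidual. *)
have : {ptws, (fun n => rho (approx_unit n)) @ \oo --> q}.
  apply/pointwise_cvgP => z P /nbhs_nrm[e e0 He].
  have [n0 Hn0] := Qlim z e e0; exists n0 => // n /= nn; apply: He.
  rewrite rho_approx_unit /q opprB addrC addrA subrK nrmBC.
  exact: Hn0.
move=> /(_ N Nq)[n0 _ /(_ n0 (leqnn _))] Nn0.
by exists (rho (approx_unit n0)); split=> //; exists (approx_unit n0).
Qed.

End UnitInterval.

(** Hahn-Banach gives x^* x <= d - b with b in [B]. For f = 1 - (1 - k)^n, k a multiple of b^2, the
    vector (x - x f) z is x u with u = (1 - k)^n z, and its squared norm is at most d norm u ^ 2 +
    norm (b u) norm u, where b u is small for large n. *)
Lemma approx_of_states x :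
  (forall phi : A -> R[i], is_state phi -> (forall b, B b -> phi b = 0) ->
    complex.Re (phi (x^# ** x)) <= 0) ->
  forall e, 0 < e -> exists2 f, B f & nrm (x - x ** f) < e.
Proof.
(* The two error terms add up to 2 d = (e / 2)^2. *)
move=> Hphi e e0; pose d := e ^+ 2 / 8.
have d0 : 0 < d by rewrite divr_gt0// exprn_gt0.
have [b [Bb bsa] Hb] : exists2 b, B b /\ b^# = b & dominated d (x^# ** x + b).
  apply: (@dominated_of_states _ _ [set b | B b /\ b^# = b]) => //.
  - by split=> //; exact: cstar0.
  - move=> a c [Ba asa] [Bc csa]; split; first exact: BD.
    by rewrite cstarD asa csa.
  - by move=> r c [Bc csa]; split; [exact: BZ|rewrite cstarZr csa].
  - by move=> c [].
  - exact: cstar_pos.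
  - move=> phi sphi phi0; apply: Hphi => // c Bc.
    have [phil _ _] := sphi.
    rewrite [c]cartesian (scalar_mul _ _ phil) addrC -scaleNr phil.
    rewrite !phi0 ?mulr0 ?addr0 ?mulr0//.
      by split; [exact: BD (Bstar Bc)|exact: cartesian_re].
    split; last exact: cartesian_im.
    by apply: BZ; apply: BB => //; exact: Bstar.
pose M := nrm b ^+ 2 + 1; have M0 : 0 < M by rewrite ltr_wpDl// sqr_ge0.
(* [b] is only self-adjoint; its square is positive, and [M] scales it into the unit ball. *)
pose k := M^-1%:C *: (b ** b).
have Mi : 0 <= M^-1 by rewrite invr_ge0 ltW.
have Bk : B k by apply: BZ; exact: BM.
have ksa : k^# = k by rewrite cstarZr cstarM bsa.
have kform z : ip (rho k z) z = M^-1 * nrm (rho b z) ^+ 2.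
  by rewrite (rhoZl rho_univ) ipZl -{1}bsa (ip_rho_starM rho_univ) ipxx.
have kpos z : 0 <= ip (rho k z) z by rewrite kform mulr_ge0 ?sqr_ge0.
have k1 : nrm k <= 1.
  rewrite nrmZp// ler_pdivrMl// mulr1; apply: le_trans (nrmM _ _) _.
  by rewrite -expr2 lerDl.
(* By [mul_iter_compl_form] for [k], (n + 1) norm (b u) ^ 2 <= M norm z ^ 2; this n makes norm (b u)
   at most d norm z. *)
have [n Hn] := exists_natM_gt M (exprn_gt0 2 d0).
exists (approx_unit k n); first exact: approx_unit_in.
suff : nrm (x - x ** approx_unit k n) <= e / 2 by lra.
apply: (rho_isometric rho_univ) => [|z]; first by rewrite divr_ge0// ltW.
rewrite (rhoBl rho_univ) (rhoM rho_univ) -(rhoBr rho_univ).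
rewrite (rho_approx_unit k) subKr.
set T := compl_op (rho k); pose u := iter n T z; rewrite -/u.
have ksym v w : ip (rho k v) w = ip v (rho k w).
  by rewrite (rho_adj rho_univ) ksa.
have kle v : nrm (rho k v) <= nrm v.
  apply: le_trans (nrm_rho rho_univ k v) _.
  by rewrite -[leRHS]mul1r ler_wpM2r ?nrm_ge0.
have uz : nrm u <= nrm z.
  exact: (nrm_iter_compl_le (rho_linear rho_univ k) ksym kpos kle).
have bu : nrm (rho b u) <= d * nrm z.
  rewrite -(@ler_pXn2r _ 2) ?nnegrE ?(mulr_ge0 (ltW d0)) ?nrm_ge0//.
  have := mul_iter_compl_form (rho_linear rho_univ k) ksym kle n z.
  rewrite -/T -/u kform mulrCA ler_pdivrMl// => h.
  have n1 : 0 < n.+1%:R :> R by rewrite ltr0n.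
  rewrite -(ler_pM2l n1); apply: le_trans h _.
  rewrite exprMn [leRHS]mulrA ler_wpM2r ?sqr_ge0//; apply: le_trans (ltW Hn) _.
  by rewrite ler_wpM2r ?sqr_ge0// ler_nat.
have csa : (x^# ** x + b)^# = x^# ** x + b by rewrite cstarD cstar_pos bsa.
have := dominated_rho rho_univ u (ltW d0) csa Hb.
rewrite (rhoDl rho_univ) ipDl (ip_rho_starM rho_univ) ipxx => Hu.
rewrite -(@ler_pXn2r _ 2) ?nnegrE ?mulr_ge0 ?nrm_ge0 ?invr_ge0 ?(ltW e0)//.
have cs : - ip (rho b u) u <= nrm (rho b u) * nrm u.
  have := cauchy_schwarz (- rho b u) u.
  by rewrite nrmN -[- rho b u]sub0r ipBl ip0l sub0r.
have t1 := ler_pM (nrm_ge0 _) (nrm_ge0 _) bu uz.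
have t2 : nrm u ^+ 2 <= nrm z ^+ 2 by rewrite ler_pXn2r ?nnegrE ?nrm_ge0.
have t3 := ler_wpM2l (ltW d0) t2.
rewrite exprMn (_ : (e / 2) ^+ 2 = 2 * d); last by rewrite /d; lra.
rewrite expr2 in t3 *; lra.
Qed.

(** [h] is a weighted sum of the (u k)^* (u k) over a dense sequence of [B]. A vector killed by [h]
    is killed by every summand, hence by every [u k], hence by [B]. *)
Lemma strictly_positive : separable_space A -> exists h,
  [/\ B h, h^# = h, nrm h <= 1, forall z, 0 <= ip (rho h z) z &
    forall z, rho h z = 0 -> forall b, B b -> rho b z = 0].
Proof.
move=> sepA; have [u [Bu du]] := separable_dense_seq HB sepA.
(* The weights give the k-th summand norm at most 2^-(k+1), so the series converges and its sum has
   norm at most 1. *)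
pose c k : R := 2^-1 * 2^-1 ^+ k / (1 + nrm (u k) ^+ 2).
have p0 k : 0 < 1 + nrm (u k) ^+ 2 by rewrite ltr_wpDr// sqr_ge0.
have h0 : 0 < 2^-1 :> R by rewrite invr_gt0.
have c0 k : 0 < c k by rewrite divr_gt0// mulr_gt0// exprn_gt0.
pose s k := (c k)%:C *: ((u k)^# ** u k).
pose S n := \sum_(k < n) s k.
have SS n : S n.+1 = S n + s n by rewrite /S big_ord_recr.
have S0 : S 0%N = 0 by rewrite /S big_ord0.
have Sd n : nrm (S n.+1 - S n) <= 2^-1 * 2^-1 ^+ n.
  rewrite SS addrC addrA addNr add0r /s nrmZp ?(ltW (c0 _))// nrm_starM /c.
  by rewrite mulrAC ler_pdivrMr// ler_wpM2l ?lerDr.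
have h01 : 0 <= (2^-1 : R) < 1 by rewrite (ltW h0)/=; lra.
have [h Hh] := nrm_geometric_lim (ltW h0) h01 Sd.
have {}Hh n : nrm (h - S n) <= 2^-1 ^+ n.
  have := Hh n; rewrite (_ : 1 - 2^-1 = 2^-1 :> R); last lra.
  by rewrite divff ?mul1r// gt_eqF.
have small e : 0 < e -> exists n : nat, 2^-1 ^+ n < e.
  move=> e0; have [n] := geometric_small h01 ler01 e0.
  by rewrite mul1r => Hn; exists n.
have BS n : B (S n).
  elim: n => [|n IH]; first by rewrite S0.
  by rewrite SS; apply: BD => //; apply: BZ; apply: BM => //; exact: Bstar.
have Ssa n : (S n)^# = S n.
  elim: n => [|n IH]; first by rewrite S0 cstar0.
  by rewrite SS cstarD IH /s cstarZr cstar_pos.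
have sform k z : ip (rho (s k) z) z = c k * nrm (rho (u k) z) ^+ 2.
  by rewrite (rhoZl rho_univ) ipZl (ip_rho_starM rho_univ) ipxx.
have spos k z : 0 <= ip (rho (s k) z) z by rewrite sform mulr_ge0 ?sqr_ge0 ?ltW.
have Sform n z k : (k < n)%N -> ip (rho (s k) z) z <= ip (rho (S n) z) z.
  have Spos m : 0 <= ip (rho (S m) z) z.
    elim: m => [|m IH]; first by rewrite S0 (rho0l rho_univ) ip0l.
    by rewrite SS (rhoDl rho_univ) ipDl addr_ge0.
  elim: n => // n IH; rewrite ltnS leq_eqVlt => /predU1P[->|/IH {}IH].
    by rewrite SS (rhoDl rho_univ) ipDl lerDr.
  by rewrite SS (rhoDl rho_univ) ipDl; apply: le_trans IH _; rewrite lerDl.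
have hform z k : ip (rho (s k) z) z <= ip (rho h z) z.
  apply/ler_addgt0Pl => e e0.
  have q0 : 0 < nrm z ^+ 2 + 1 by rewrite ltr_wpDl// sqr_ge0.
  have [n Hn] := small _ (divr_gt0 e0 q0).
  (* The partial sum of index [n + k.+1] contains [s k] and is at least as close to [h] as
     required. *)
  have Hm : 2^-1 ^+ (n + k.+1) <= (2^-1 : R) ^+ n.
    by rewrite exprD ler_piMr ?exprn_ge0 ?exprn_ile1// ?(ltW h0)//; lra.
  have h1 := Sform (n + k.+1)%N z k (leq_addl _ _).
  apply: le_trans h1 _.
  have := cauchy_schwarz (rho (S (n + k.+1)%N - h) z) z.
  rewrite {1}(rhoBl rho_univ) ipBl.
  have h2 := nrm_rho rho_univ (S (n + k.+1)%N - h) z.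
  have h3 : nrm (S (n + k.+1)%N - h) * nrm z ^+ 2 <= e.
    rewrite nrmBC; apply: le_trans (ler_wpM2r (sqr_ge0 _) (Hh _)) _.
    apply: le_trans (ler_wpM2r (sqr_ge0 _) Hm) _.
    move: Hn; rewrite ltr_pdivlMr// mulrDr mulr1.
    have : 0 <= (2^-1 : R) ^+ n by rewrite exprn_ge0// ltW.
    lra.
  have := ler_wpM2r (nrm_ge0 z) h2; rewrite -mulrA -expr2; lra.
exists h; split.
- case: HB => -[/closed_nrmP cB _ _ _ _ _]; apply: cB => e e0.
  have [n Hn] := small e e0; exists (S n) => //.
  exact: le_lt_trans (Hh n) Hn.
- apply/eqP; rewrite -subr_eq0; apply/eqP; apply: nrm_le0 => e e0.
  have e2 : 0 < e / 2 by rewrite divr_gt0.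
  have [n Hn] := small _ e2.
  have -> : h^# - h = (h - S n)^# - (h - S n).
    by rewrite cstarB Ssa opprB addrA subrK.
  apply: le_trans (nrmB _ _) _; rewrite nrm_star; have := Hh n; lra.
- by have := Hh 0%N; rewrite S0 subr0 expr0.
- by move=> z; apply: le_trans (hform z 0%N).
- move=> z hz b Bb; apply: nrm_le0 => e e0.
  have uz k : rho (u k) z = 0.
    have := hform z k; rewrite hz ip0l sform pmulr_rle0//.
    move=> uz; apply/nrm0_eq0/eqP; rewrite -sqrf_eq0 eq_le sqr_ge0 andbT.
    exact: uz.
  have q0 : 0 < nrm z + 1 by rewrite ltr_wpDl// nrm_ge0.
  have [n Hn] := du b _ Bb (divr_gt0 e0 q0).
  rewrite -[rho b z]subr0 -(uz n) -(rhoBl rho_univ).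
  apply: le_trans (nrm_rho rho_univ _ _) _.
  move: Hn; rewrite ltr_pdivlMr// mulrDr mulr1; have := nrm_ge0 (b - u n); lra.
Qed.

Lemma support_projection : separable_space A -> exists q,
  [/\ bidual_projection rho q,
    forall z, (forall b, B b -> rho b z = 0) -> q z = 0 &
    forall p, bidual_projection rho p ->
      (forall z, (forall b, B b -> rho b z = 0) -> p z = 0) -> proj_le p q].
Proof.
move=> sepA; have [h [Bh hsa h1 hpos hker]] := strictly_positive sepA.
have [q [bq q0 hq]] := range_projection hsa hpos h1.
exists q; split=> // [z Hz|p bp Hp z]; first by apply: q0; exact: Hz.
have op := bidual_orthoproj bp; have oq := bidual_orthoproj bq.
have form (r : H -> H) : bidual_projection rho r ->
    inner (r z) z = (nrm (r z) ^+ 2)%:C.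
  by move=> [_ rr rs]; rewrite rmorphXn/= -nrmE norm_inner -[in RHS]rs rr.
rewrite !form// lecR ler_pXn2r ?nnegrE ?nrm_ge0//.
(* [h] kills z - q z, so all of [B] does, and [p] with it. *)
have -> : p z = p (q z).
  apply/eqP; rewrite -subr_eq0 -orthoprojB//; apply/eqP; apply: Hp => b.
  by apply: hker; exact: hq.
exact: orthoproj_nrm.
Qed.

End SupportProjection.

(** The net lies in A_p: if p v = 0, the forms of the [a i] at [v] are nonnegative and increase to
    that of [p], which is 0, so each [a i] kills [v]. Hence the net lies in [B], and p z is a limit
    of vectors [rho (a i) z] that all vanish. *)
Lemma open_projection_kernel {R : realType} {A : cstarAlgType R}
    {H : hilbertType R} (rho : A -> H -> H) (p : H -> H) (B : set A) :
  is_universal_representation rho -> open_projection rho p ->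
  hereditary_of rho p `<=` B ->
  forall z, (forall b, B b -> rho b z = 0) -> p z = 0.
Proof.
move=> ru [bp [I [le [a [[[i0 _] lerefl letrans ledir] apos amono aptws]]]]] pB z Hz.
have net : Filter (net_filter le).
  apply: filter_from_filter; first by exists i0.
  move=> i j _ _; have [k [ik jk]] := ledir i j; exists k => // l /= kl.
  by split; [exact: letrans kl|exact: letrans kl].
have op := bidual_orthoproj bp.
have lim v i (e : R) : 0 < e -> exists2 j, le i j & nrm (p v - rho (a j) v) < e.
  move=> e0; have /pointwise_cvgP -/(_ v) := aptws.
  move=> /(_ [set y | nrm (p v - y) < e])[|k _ Hk].
    by apply/nbhs_nrm; exists e.
  by have [j [ij kj]] := ledir i k; exists j => //; exact: Hk.
have aB i : B (a i).
  apply: pB; have [x ax] := apos i.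
  apply: (hereditary_of_selfadjoint ru op) => [|v pv].
    by rewrite ax cstar_pos.
  rewrite ax (rhoM ru) (_ : rho x v = 0) ?(rho0r ru)//.
  apply: (rho_star_mul_eq0 ru); apply/eqP; rewrite eq_le; apply/andP; split.
    apply/ler_addgt0Pl => e e0; rewrite addr0 -ax.
    have n0 : 0 < nrm v + 1 by rewrite ltr_wpDl// nrm_ge0.
    have [j ij Hj] := lim v i _ (divr_gt0 e0 n0).
    have [y yE] := amono _ _ ij.
    have : 0 <= ip (rho (a j - a i) v) v.
      by rewrite yE (ip_rho_starM ru) ipxx sqr_ge0.
    rewrite (rhoBl ru) ipBl; have := cauchy_schwarz (rho (a j) v) v.
    move: Hj; rewrite pv sub0r nrmN ltr_pdivlMr// mulrDr mulr1.
    by have := nrm_ge0 (rho (a j) v); lra.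
  by rewrite (ip_rho_starM ru) ipxx sqr_ge0.
apply: nrm_le0 => e e0; have [j _] := lim z i0 e e0.
by rewrite Hz// subr0 => /ltW.
Qed.

Theorem proposition2p3 (R : realType) (A : cstarAlgType R)
    (Asep : separable_space A)
    (H : hilbertType R) (rho : A -> H -> H)
    (rho_univ : is_universal_representation rho)
    (p_ : nat -> H -> H) (p_open : forall n, open_projection rho (p_ n))
    (p : H -> H) (p_sup : is_proj_sup rho p_ p) :
  hereditary_of rho p =
  hereditary_generated (\bigcup_n hereditary_of rho (p_ n)).
Proof.
have [bp pup pleast] := p_sup; have op := bidual_orthoproj bp.
have bpn n : bidual_projection rho (p_ n) by have [] := p_open n.
set B := hereditary_generated _.
have HB : hereditary_cstar_subalgebra B := hereditary_generated_subalgebra _.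
have pB n : hereditary_of rho (p_ n) `<=` B.
  by move=> a Ha W [_ WS]; apply: WS; exists n.
rewrite eqEsubset; split; last first.
  apply: smallest_sub; first exact: hereditary_of_subalgebra.
  move=> a [n _]; apply: hereditary_of_mono => //.
  exact: bidual_orthoproj.
have [q [bq q0 qmax]] := support_projection rho_univ HB Asep.
have pq : proj_le p q.
  apply: pleast => // n; apply: qmax => // z.
  exact: open_projection_kernel rho_univ (p_open n) (pB n) z.
have [xi [Hphi _]] := state_vector rho_univ.
have key a : (forall z, p z = 0 -> rho a z = 0) ->
    forall e : R, 0 < e -> exists2 f, B f & nrm (a - a ** f) < e.
  move=> Ha; apply: (approx_of_states rho_univ HB) => phi sphi phiB.
  (* phi (b^* b) is the squared norm of b applied to [xi phi], so this vector lies in the common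
     kernel of [B]. *)
  have xi0 : p (xi phi) = 0.
    apply: (proj_leP op (bidual_orthoproj bq) pq); apply: q0 => b Bb.
    apply: (rho_star_mul_eq0 rho_univ); rewrite /ip -Hphi//.
    rewrite phiB//; case: HB => _ BM Bs _; apply: BM => //; exact: Bs.
  by rewrite Hphi// (rhoM rho_univ) Ha// (rho0r rho_univ) -/(ip _ _) ip0l.
have kill a : hereditary_of rho p a -> forall z, p z = 0 -> rho a z = 0.
  have [_ pp _] := op => /(hereditary_ofP rho_univ a pp) Ha z pz.
  by rewrite Ha pz (rho0r rho_univ) (orthoproj0 op).
have [_ _ pstar _] := hereditary_of_subalgebra rho_univ op.
move=> a Ha; apply: (hereditary_of_approx HB); apply: key; apply: kill => //.
exact: pstar.
Qed.
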